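(* Let $I$ be an arbitrary index set. Equip $\mathcal C(\bar{\mathbb R}^I)$ and $\mathcal P(\bar{\mathbb R}^I)$ with the topology of weak convergence of the finite-dimensional distributions, each $\mathcal P(\bar{\mathbb R})$ with the topology of weak convergence, and $\mathcal C(\bar{\mathbb R}^I)\times\prod_{i\in I}\mathcal P(\bar{\mathbb R})$ with the product topology. Then the map $$\Phi:\mathcal C(\bar{\mathbb R}^I)\times\prod_{i\in I}\mathcal P(\bar{\mathbb R})\to\mathcal P(\bar{\mathbb R}^I),\qquad \Phi\big(C,(\mu_i)_{i\in I}\big):=\big((F_{\mu_i}^{[-1]})_{i\in I}\big)_*C,$$ is continuous and surjective. In particular, for every $\mu\in\mathcal P(\bar{\mathbb R}^I)$ there is a copula measure $C$ with $\mu=\Phi(C,(\mu_i)_{i\in I})$, which satisfies $F_{C_J}((F_{\mu_j}(x_j))_{j\in J})=F_{\mu_J}((x_j)_{j\in J})$ for all finite $J\subseteq I$ and all $(x_j)_{j\in J}\in\bar{\mathbb R}^J$.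
   Context: $\bar{\mathbb R}=[-\infty,\infty]$ with Borel $\sigma$-algebra $\mathcal B(\bar{\mathbb R})$; $\mathcal P(\bar{\mathbb R}^I)$ is the set of probability measures on $(\bar{\mathbb R}^I,\otimes_{i\in I}\mathcal B(\bar{\mathbb R}))$ and $\mathcal P(\bar{\mathbb R})$ the Borel probability measures on $\bar{\mathbb R}$. For $J\subseteq I$, $\mu_J:=(\pi_J)_*\mu$ with $\pi_J$ the canonical projection, $\mu_i:=\mu_{\{i\}}$. A copula measure is a $C\in\mathcal P(\bar{\mathbb R}^I)$ all of whose one-dimensional marginals $C_i$ are uniform on $[0,1]$; $\mathcal C(\bar{\mathbb R}^I)$ is the set of these. For finite $J$ and a probability measure $\nu$ on $\bar{\mathbb R}^J$, $F_\nu((x_j))=\nu(\prod_{j\in J}[-\infty,x_j])$; for $\nu$ on $\bar{\mathbb R}$, $F_\nu(x)=\nu([-\infty,x])$. Quantile function: $F_\nu^{[-1]}(u):=\inf\{x\in(-\infty,\infty):F_\nu(x)\ge u\}$ for $u\in\bar{\mathbb R}$, with $\inf\emptyset=+\infty$ and $\inf$ of a set unbounded below $=-\infty$; $(F_{\mu_i}^{[-1]})_{i\in I}$ acts coordinatewise on $\bar{\mathbb R}^I$. Let $\mathcal I$ be the set of finite subsets of $I$, each $\mathcal P(\bar{\mathbb R}^J)$ with the weak topology. The topology of weak convergence of the finite-dimensional distributions on $\mathcal P(\bar{\mathbb R}^I)$ is the topology transported via $\mu\mapsto(\mu_J)_{J\in\mathcal I}$ onto the set of consistent families $\{(\nu_J)\in\prod_{J\in\mathcal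 I}\mathcal P(\bar{\mathbb R}^J):(\pi_{J_1,J_2})_*\nu_{J_2}=\nu_{J_1}\ \forall J_1\subseteq J_2\}$ with the subspace product topology; equivalently the coarsest topology making every $\mu\mapsto\mu_J$, $J\in\mathcal I$, continuous. *)

(* Defs.v *)
From HB Require Import structures.
From mathcomp Require Import all_boot all_order all_algebra.
From mathcomp Require Import all_classical all_reals all_analysis.
From mathcomp Require Import measurable_realfun lebesgue_Rintegral.
Set Implicit Arguments. Unset Strict Implicit. Unset Printing Implicit Defensive.
Import Order.TTheory GRing.Theory Num.Theory.
Import numFieldNormedType.Exports.
Local Open Scope classical_set_scope.
Local Open Scope ring_scope.

Section Defs.
Variable R : realType.

Definition cyl (K : Type) : set (set (K -> \bar R)) :=
  \bigcup_(k in [set: K])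
     preimage_set_system [set: K -> \bar R] (fun x => x k) (@measurable _ (\bar R)).

Definition ebarP (K : Type) := g_sigma_algebraType (@cyl K).

Definition proj (K : Type) (k : K) : ebarP K -> \bar R := fun x => x k.

Lemma proj_measurable (K : Type) (k : K) : measurable_fun [set: ebarP K] (proj k).
Proof.
move=> _ A mA; apply: sub_sigma_algebra; exists k => //; exists A => //.
Qed.

HB.instance Definition _ K k :=
  isMeasurableFun.Build _ _ (ebarP K) (\bar R) (@proj K k) (@proj_measurable K k).

Definition FinSub (I : Type) := {J : set I | finite_set J}.
Definition Jt (I : Type) (J : FinSub I) := {i : I | proj1_sig J i}.

Definition restr (I : Type) (J : FinSub I) : ebarP I -> ebarP (Jt J) :=
  fun x j => x (proj1_sig j).

Lemma restr_measurable (I : Type) (J : FinSub I) :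
  measurable_fun [set: ebarP I] (@restr I J).
Proof.
apply: (@measurability _ _ (ebarP I) (ebarP (Jt J)) [set: ebarP I] (@restr I J)
  (@cyl (Jt J))).
  by [].
move=> _ [B [j _ [A mA <-]] <-]; apply: sub_sigma_algebra.
exists (proj1_sig j) => //; exists A => //.
by rewrite !setTI.
Qed.

HB.instance Definition _ I J :=
  isMeasurableFun.Build _ _ (ebarP I) (ebarP (Jt J)) (@restr I J)
    (@restr_measurable I J).

Definition margJ (I : Type) (mu : probability (ebarP I) R) (J : FinSub I)
  : probability (ebarP (Jt J)) R := distribution mu (@restr I J).

Definition marg1 (I : Type) (mu : probability (ebarP I) R) (i : I)
  : probability (\bar R) R := distribution mu (@proj I i).

Definition CB (U : topologicalType) :=
  {f : U -> R | continuous f /\ exists M : R, forall x, `|f x| <= M}.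

(** weak convergence topology on P(\bar R^K) (K will be finite) : the
    coarsest topology making nu |-> \int f dnu continuous, f bounded continuous *)
Definition wmapK (K : Type) (nu : probability (ebarP K) R)
  : {ptws CB {ptws K -> \bar R} -> R} := fun f => \int[nu]_x (proj1_sig f x).
Definition WPK (K : Type) : topologicalType := initial_topology (@wmapK K).

Definition wmap1 (nu : probability (\bar R) R) : {ptws CB (\bar R) -> R} :=
  fun f => \int[nu]_x (proj1_sig f x).
Definition WP1 : topologicalType := initial_topology wmap1.

Definition fdd (I : Type) (mu : probability (ebarP I) R)
  : prod_topology (fun J : FinSub I => WPK (Jt J)) := fun J => margJ mu J.
Definition PIw (I : Type) : topologicalType := initial_topology (@fdd I).

Definition is_copula (I : Type) (C : probability (ebarP I) R) : Prop :=
  forall (i : I) (A : set (\bar R)), measurable A ->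
    marg1 C i A = lebesgue_measure ((EFin @^-1` A) `&` [set x : R | 0 <= x <= 1]).

Definition cdf1 (nu : set (\bar R) -> \bar R) (x : \bar R) : \bar R :=
  nu [set y | (y <= x)%E].
Definition cdfJ (K : Type) (nu : set (ebarP K) -> \bar R) (v : K -> \bar R)
  : \bar R := nu [set y | forall k, (y k <= v k)%E].

Definition quantile (nu : set (\bar R) -> \bar R) (u : \bar R) : \bar R :=
  ereal_inf [set x%:E | x in [set x : R | (u <= cdf1 nu x%:E)%E]].

Definition qmap (I : Type) (m : I -> probability (\bar R) R) (x : I -> \bar R)
  : I -> \bar R := fun i => quantile (m i) (x i).

End Defs.

(* Main.v *)
Require Import Defs.
From HB Require Import structures.
From mathcomp Require Import all_boot all_order all_algebra.
From mathcomp Require Import all_classical all_reals all_analysis.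
From mathcomp Require Import measurable_realfun lebesgue_Rintegral.
From mathcomp Require Import ring lra.
Import Order.TTheory GRing.Theory Num.Theory.
Import numFieldNormedType.Exports.
Local Open Scope classical_set_scope.
Local Open Scope ring_scope.

(* Continuity: in the compact coordinate [contract] of the extended line, a quantile
   function is approximated, off a small set of levels in [0, 1], by one continuous
   function [g] valid for all marginals weakly close to a given one.  Every copula
   measure gives such a set of levels small mass in each coordinate, so for [f]
   continuous on a finite power of the extended line (hence uniformly continuous)
   the integral of [f o q] is uniformly close to that of [f o g], and the latter
   depends continuously on the copula measure.

   Surjectivity: given [mu], put [U_i := F_i(x_i-) + V (F_i(x_i) - F_i(x_i-))] with a
   single [V] uniform on [0, 1] and independent of [x].  Each [U_i] is uniform, and
   [q_i(U_i) <= x_i] with both sides equally distributed, so [q_i(U_i) = x_i] almost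
   surely; the law of [U] is the copula measure sought. *)

(** * Quantile functions *)

(** A quantile function jumps across every flat stretch of its distribution function, and [C] moves
    together with the marginals, so [f o q] is neither a continuous nor a fixed test function. The
    index set is arbitrary and all topologies are initial ones, so convergence is handled by
    neighbourhood filters and the error bounds have to be uniform in [C]. This is why the
    exceptional set is a set of levels: its mass in a coordinate is the same for every copula
    measure. Both halves rest on the Galois connection [q(u) <= x] iff [u <= F(x)]. It translates
    closeness of quantiles into closeness of distribution functions, which continuous test functions
    detect up to one grid step. It also makes [q_i(U_i) <= x_i] and [U_i <= F_i(x_i)] the same
    event, which yields the formula for the finite-dimensional distribution functions. *)

Section Quantile.
Local Open Scope ereal_scope.
Context {R : realType}.
Implicit Types (m : probability (\bar R) R) (x y u : \bar R).

Lemma measurable_ray_le x : measurable [set y : \bar R | y <= x].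
Proof.
by rewrite -set_itvNyc; exact: emeasurable_itv.
Qed.

Lemma measurable_ray_lt x : measurable [set y : \bar R | y < x].
Proof.
by rewrite -set_itvNyo; exact: emeasurable_itv.
Qed.

Lemma cdf1_ge0 m x : 0 <= cdf1 m x.
Proof. exact: measure_ge0. Qed.

Lemma cdf1_le1 m x : cdf1 m x <= 1.
Proof. by apply: probability_le1; exact: measurable_ray_le. Qed.

Lemma cdf1_homo m : {homo cdf1 m : x y / x <= y}.
Proof.
move=> x y xy; apply: le_measure; rewrite ?inE; [exact: measurable_ray_le..|].
by move=> z /= /le_trans; exact.
Qed.

Lemma cdf1_pinfty m : cdf1 m +oo = 1.
Proof.
rewrite /cdf1 (_ : [set _ | _] = setT) ?probability_setT//.
by apply/seteqP; split => // y _ /=; rewrite leey.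
Qed.

(** Sequences tending to [x] strictly from above and from below. In the coordinate [contract] finite
    and infinite points are treated alike, and [expand] clamps whatever leaves [-1, 1]. *)
Let above (x : \bar R) (n : nat) : \bar R := expand (contract x + n.+1%:R^-1)%R.
Let below (x : \bar R) (n : nat) : \bar R := expand (contract x - n.+1%:R^-1)%R.

Let inv_gt0 n : (0 < n.+1%:R^-1 :> R)%R.
Proof. by rewrite invr_gt0 ltr0n. Qed.

Let inv_homo n p : (n <= p)%N -> (p.+1%:R^-1 <= n.+1%:R^-1 :> R)%R.
Proof. by move=> np; rewrite lef_pV2 ?posrE ?ltr0n// ler_nat. Qed.

Let inv_small (e : R) : (0 < e)%R -> exists n, (n.+1%:R^-1 < e)%R.
Proof.
move=> e0; have [n _ /(_ n (leqnn n)) ne] := near_infty_natSinv_lt (PosNum e0).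
by exists n.
Qed.

Let above_gt x n : x < +oo -> x < above x n.
Proof.
move=> xoo; rewrite /above; have [le1|gt1] := leP (contract x + n.+1%:R^-1)%R 1%R.
  rewrite lt_expandRL ?inE ?ltrDl//.
  rewrite ler_norml le1 andbT.
  have := contract_le1 x; rewrite ler_norml => /andP[+ _].
  by move/le_trans; apply; rewrite lerDl ltW.
by rewrite expand1// ltW.
Qed.

Let below_lt x n : -oo < x -> below x n < x.
Proof.
move=> xoo; rewrite /below; have [le1|gt1] := leP (-1)%R (contract x - n.+1%:R^-1)%R.
  rewrite lt_expandLR ?inE ?gtrDl ?oppr_lt0//.
  rewrite ler_norml le1/=.
  have := contract_le1 x; rewrite ler_norml => /andP[_].
  by apply: le_trans; rewrite gerDl oppr_le0 ltW.
by rewrite expandN1// ltW.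
Qed.

Let above_homo x n p : (n <= p)%N -> above x p <= above x n.
Proof. by move=> np; apply: le_expand; rewrite lerD2l inv_homo. Qed.

Let below_homo x n p : (n <= p)%N -> below x n <= below x p.
Proof. by move=> np; apply: le_expand; rewrite lerD2l lerN2 inv_homo. Qed.

(** Right continuity of the distribution function, including at [-oo]. *)
Lemma cdf1_ge m x u : x < +oo -> (forall z, x < z -> u <= cdf1 m z) -> u <= cdf1 m x.
Proof.
move=> xoo h.
have hx : [set y | y <= x] = \bigcap_n [set y | y <= above x n].
  apply/seteqP; split => [y /= yx n _ /=|y /= hy].
    by rewrite (le_trans yx)// ltW// above_gt.
  rewrite leNgt; apply/negP => xy.
  have cxy : (0 < contract y - contract x)%R by rewrite subr_gt0 lt_contract.
  have [n ne] := inv_small _ cxy.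
  have := hy n I; apply/negP; rewrite -ltNge /above.
  rewrite lt_expandLR ?inE ?ltrBrDl// -?ltrBrDl//.
  have := contract_le1 y; rewrite !ler_norml => /andP[_ y1].
  apply/andP; split; last by rewrite (le_trans _ y1)// -lerBrDl ltW.
  have := contract_le1 x; rewrite ler_norml => /andP[x1 _].
  by rewrite (le_trans x1)// lerDl ltW.
rewrite /cdf1 hx.
have mA n : measurable [set y | y <= above x n] by exact: measurable_ray_le.
have h1 : (m \o (fun n => [set y | y <= above x n])) @ \oo -->
    m (\bigcap_n [set y | y <= above x n]).
  apply: nonincreasing_cvg_mu => //.
  - by rewrite (le_lt_trans (probability_le1 _ _))// ltry.
  - exact: bigcap_measurable.
  - move=> n p np; apply/subsetPset => y /= /le_trans; apply; exact: above_homo.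
apply: (cvge_to_ge h1); apply: nearW => n /=; apply: h; exact: above_gt.
Qed.

Lemma measure_ray_lt_le m x u : -oo < x -> (forall z, z < x -> cdf1 m z <= u) ->
  m [set y | y < x] <= u.
Proof.
move=> xoo h.
have -> : [set y | y < x] = \bigcup_n [set y | y <= below x n].
  apply/seteqP; split => [y /= yx|y /= [n _ /= yn]]; last first.
    by rewrite (le_lt_trans yn)// below_lt.
  have cxy : (0 < contract x - contract y)%R by rewrite subr_gt0 lt_contract.
  have [n ne] := inv_small _ cxy.
  exists n => //=; rewrite /below -[leLHS]contractK; apply: le_expand.
  by rewrite lerBrDl -lerBrDr ltW.
have mA n : measurable [set y | y <= below x n] by exact: measurable_ray_le.
have h1 : (m \o (fun n => [set y | y <= below x n])) @ \oo -->
    m (\bigcup_n [set y | y <= below x n]).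
  apply: nondecreasing_cvg_mu => //; first exact: bigcup_measurable.
  by move=> n p np; apply/subsetPset => y /= /le_trans; apply; exact: below_homo.
apply: (cvge_to_le h1); apply: nearW => n /=; apply: h; exact: below_lt.
Qed.

(** The Galois connection. The point [+oo] is excluded because a level above 1 has quantile [+oo]
    although F is 1 there; for levels at most 1 the exclusion disappears. *)
Lemma quantile_le m u x : x < +oo -> (quantile m u <= x) = (u <= cdf1 m x).
Proof.
move=> xoo; apply/idP/idP => [qx|ux].
  apply: cdf1_ge => // z xz.
  have /ereal_inf_lt[_ [r /= ur <-] rz] := le_lt_trans qx xz.
  by rewrite (le_trans ur)// cdf1_homo// ltW.
(* The infimum runs over real numbers only, so at [-oo] every real number must be shown to be
   admissible. *)
case: x xoo ux => [r _ ur|//|_ ux]; first by apply: ereal_inf_lbound; exists r.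
rewrite leeNy_eq; apply/eqP/eq_ninfty => r.
apply: ereal_inf_lbound; exists r => //=.
by rewrite (le_trans ux)// cdf1_homo// leNye.
Qed.

Lemma quantile_le1 m u x : u <= 1 -> (quantile m u <= x) = (u <= cdf1 m x).
Proof.
move=> u1; have [->|xoo] := eqVneq x +oo; first by rewrite cdf1_pinfty leey u1.
by rewrite quantile_le// ltey.
Qed.

Lemma measurable_quantile m : measurable_fun setT (quantile m).
Proof.
apply: (measurability _ (ErealGenOInfty.measurableE R)) => _ [_ [r ->] <-].
rewrite setTI -[X in measurable X]setCK; apply: measurableC.
rewrite (_ : ~` _ = [set u | u <= cdf1 m r%:E]); first exact: measurable_ray_le.
apply/seteqP; split => u /=.
  by rewrite in_itv/= andbT -quantile_le ?ltry// leNgt => /negP.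
by rewrite in_itv/= andbT -quantile_le ?ltry// leNgt => /negP.
Qed.

(** The half [F(q-) <= u] of [F(q-) <= u <= F(q)]; the other half is the Galois connection at
    [x = q]. *)
Lemma measure_ray_lt_quantile m u : 0 <= u <= 1 -> m [set y | y < quantile m u] <= u.
Proof.
move=> /andP[u0 u1]; have [->|qoo] := eqVneq (quantile m u) -oo.
  rewrite (_ : [set _ | _] = set0) ?measure0//.
  by apply/seteqP; split => // y /=; rewrite ltNge leNye.
apply: measure_ray_lt_le => [|z zq]; first by rewrite ltNye.
by apply: ltW; rewrite ltNge -quantile_le1// -ltNge.
Qed.

End Quantile.

(** * Convergence in product and initial topologies *)

Lemma continuous_eval {A : Type} {V : A -> topologicalType} (a : A) :
  continuous (fun x : prod_topology V => x a).
Proof.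
move=> x; have /cvg_sup/(_ a) h : nbhs x --> x by exact: cvg_id.
move=> W /nbhs_interior nW; apply: h => /=.
exact: (@initial_continuous _ _ (fun f : forall a, V a => f a) x W (interior_subset nW)).
Qed.

Lemma cvg_prod_topology {A : Type} {V : A -> topologicalType}
    (F : set_system (forall a, V a)) (x : prod_topology V) : Filter F ->
  (forall a, y a @[y --> F] --> x a) -> F --> x.
Proof.
move=> FF h; apply/cvg_sup => a U [W [[W' oW' <-]] W'x /filterS]; apply.
by apply: (h a); exact: open_nbhs_nbhs.
Qed.

Lemma continuous_into_prod {X : topologicalType} {A : Type}
    {V : A -> topologicalType} (G : X -> prod_topology V) :
  (forall a, continuous (fun x => G x a)) -> continuous G.
Proof.
move=> cG x.
exact: (@cvg_prod_topology A V (G @ x) (G x) _ (fun a => cG a x)).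
Qed.

Lemma cvg_initial_topology {S : choiceType} {T : topologicalType} (w : S -> T)
    (F : set_system S) (s : S) : Filter F ->
  w @ F --> w s -> F --> (s : initial_topology w).
Proof.
move=> FF h U [W [[W' oW' <-]] W's /filterS]; apply.
by apply: h; exact: open_nbhs_nbhs.
Qed.

(** * Finite powers of the extended real line *)

Section CompactCube.
Context {R : realType}.

Lemma contract_expand (r : R) : contract (expand r) = Num.max (-1) (Num.min r 1).
Proof.
have [r1|r1] := leP r 1.
  have [r2|r2] := leP (-1) r; first by rewrite expandK// inE ler_norml r1 r2.
  by rewrite expandN1// ltW.
by rewrite expand1 ?ltW//= max_r// lerN10.
Qed.

(** The composite is the retraction of the line onto [-1, 1], hence 1-Lipschitz. *)
Lemma contract_expand_dist (r s : R) :
  `|contract (expand r) - contract (expand s)| <= `|r - s|.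
Proof.
rewrite !contract_expand.
have N11 : (-1 : R) <= 1 by lra.
have h := ler_norm (r - s); have h' := ler_norm (s - r); rewrite distrC in h'.
have [r1|r1] := leP r 1; have [s1|s1] := leP s 1; rewrite ?(max_r N11);
  have [r2|r2] := leP (-1) r; have [s2|s2] := leP (-1) s;
  rewrite ler_norml; apply/andP; split; lra.
Qed.

Lemma continuous_contract : continuous (@contract R).
Proof.
move=> x; apply/cvgrPdist_lt => e e0; have := nbhsx_ballx x e e0.
by apply: filterS => y.
Qed.

Lemma continuous_expand : continuous (@expand R).
Proof.
move=> x; apply/cvg_ballP => e e0; near=> y.
rewrite /ball/= /ereal_ball; apply: (le_lt_trans (contract_expand_dist _ _)).
near: y; exact: cvgr_dist_lt.
Unshelve. all: by end_near. Qed.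

Lemma compact_ereal : compact [set: \bar R].
Proof.
have -> : [set: \bar R] = @expand R @` `[-1, 1]%classic.
  apply/seteqP; split => // x _; exists (contract x); last by rewrite contractK.
  by rewrite /= in_itv/= -ler_norml contract_le1.
apply: continuous_compact; last exact: segment_compact.
by apply: continuous_subspaceT; exact: continuous_expand.
Qed.

Lemma measurable_contract : measurable_fun [set: \bar R] (@contract R).
Proof.
apply: (measurability _ (RGenOInfty.measurableE R)) => _ [_ [r ->] <-].
rewrite setTI.
have -> : @contract R @^-1` `]r, +oo[%classic = [set x : \bar R | r < contract x].
  by apply/seteqP; split => x /=; rewrite in_itv/= andbT.
have [r1|] := leP `|r| 1.
  rewrite (_ : [set x | _] = [set x | (expand r < x)%E]).
    by rewrite -set_itvoy; exact: emeasurable_itv.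
  by apply/seteqP; split => x /=; rewrite lt_expandLR ?inE.
have cx (x : \bar R) := contract_le1 x.
rewrite ltr_normr => /orP[r1|r1].
  rewrite (_ : [set x | _] = set0) //.
  by apply/seteqP; split => x //= rx; have := cx x; rewrite ler_norml => /andP[]; lra.
rewrite (_ : [set x | _] = setT) //.
by apply/seteqP; split => x //= _; have := cx x; rewrite ler_norml => /andP[]; lra.
Qed.

Context {K : Type}.

(** Balls for the uniform distance in the coordinate [contract]. Every product neighbourhood
    contains one, whatever [K] is; they are themselves neighbourhoods when [K] is finite. *)
Definition box (x : K -> \bar R) (r : R) : set (K -> \bar R) :=
  [set z | forall k, `|contract (x k) - contract (z k)| < r].

Lemma nbhs_box (x : {ptws K -> \bar R}) (O : set {ptws K -> \bar R}) :
  nbhs x O -> exists2 r, 0 < r & box x r `<=` O.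
Proof.
pose F := filter_from [set r : R | 0 < r] (box x).
have FF : Filter F.
  apply: filter_from_filter; first by exists (1 : R); rewrite /= ltr01.
  move=> r s /= r0 s0; exists (Num.min r s); first by rewrite /= lt_min r0 s0.
  by move=> z zb; split => k; have := zb k; rewrite lt_min => /andP[].
have : F --> x.
  apply: cvg_prod_topology => k W /nbhs_ballP[r /= r0 rW].
  by exists r => // z zb; apply: rW; exact: zb.
by move=> /[apply] -[r /= r0 rO]; exists r.
Qed.

Hypothesis finK : finite_set [set: K].

Lemma finite_enum : exists s : seq {classic K}, forall k, k \in s.
Proof.
have /finite_seqP[s hs] : finite_set [set: {classic K}] by exact: finK.
by exists s => k; have : [set: {classic K}] k by []; rewrite hs.
Qed.

Lemma finite_near_forall (T : Type) (F : set_system T) (P : K -> T -> Prop) :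
  Filter F -> (forall k, \forall t \near F, P k t) ->
  \forall t \near F, forall k, P k t.
Proof.
move=> FF h; have [s hs] := finite_enum.
suff : \forall t \near F, forall k : {classic K}, k \in s -> P k t.
  by apply: filterS => t ht k; exact: ht.
elim: s {hs} => [|k s IH]; first by near=> t.
near=> t => j; rewrite inE => /predU1P[->|js]; first by near: t; exact: h.
by move: j js; near: t.
Unshelve. all: by end_near. Qed.

Lemma box_nbhs (x : {ptws K -> \bar R}) (r : R) : 0 < r -> nbhs x (box x r).
Proof.
move=> r0; apply: (@finite_near_forall _ (nbhs x) (fun k z => `|contract (x k) - contract (z k)| < r)) => k.
have /cvgrPdist_lt/(_ _ r0) : (fun z : {ptws K -> \bar R} => contract (z k)) @ x --> contract (x k).
  by apply: (@continuous_comp _ _ _ (fun z : {ptws K -> \bar R} => z k) (@contract R));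
   [exact: continuous_eval|exact: continuous_contract].
by [].
Qed.

Lemma compact_cube : compact [set: {ptws K -> \bar R}].
Proof.
have := @tychonoff {classic K} (fun=> \bar R) (fun=> setT) (fun=> compact_ereal).
by congr compact; apply/seteqP; split.
Qed.

(** Heine-Cantor by near covering: compactness is applied with the right neighbourhoods of 0 as
    filter of radii, so that a radius valid near each point becomes one valid everywhere. *)
Lemma uniform_continuity_cube (f : {ptws K -> \bar R} -> R) (e : R) :
  continuous f -> 0 < e ->
  exists2 d, 0 < d & forall x z, box x d z -> `|f x - f z| < e.
Proof.
move=> cf e0.
have /compact_near_coveringP cov := compact_cube.
have := cov R (0^'+) (fun d x => forall z, box x d z -> `|f x - f z| < e) _.
have H : forall x : {ptws K -> \bar R}, [set: {ptws K -> \bar R}] x -> \forall x' \near x & d \near 0^'+,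
   forall z, box x' d z -> `|f x' - f z| < e.
  move=> x _.
  have e2 : 0 < e / 2 by rewrite divr_gt0.
  have /nbhs_box[r r0 hr] : nbhs x [set z | `|f x - f z| < e / 2].
    by have /cvgrPdist_lt/(_ _ e2) := cf x.
  have r2 : 0 < r / 2 by rewrite divr_gt0.
  exists (box x (r / 2), [set d | d < r / 2]).
    by split => /=; [exact: box_nbhs|exact: nbhs_right_lt].
  move=> [x' d] /= [x'b dr] z zb.
  have x'r : box x r x' by move=> k; apply: (lt_trans (x'b k)); lra.
  have zr : box x r z.
    move=> k; apply: le_lt_trans (ler_distD (contract (x' k)) _ _) _.
    have := x'b k; have := zb k; lra.
  have := hr _ x'r; have := hr _ zr => /= h1 h2.
  apply: le_lt_trans (ler_distD (f x) _ _) _.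
  by rewrite (distrC _ (f x)); lra.
move=> /(_ _ H) h.
have [d [d0 hd]] : exists d, 0 < d /\ forall x z, box x d z -> `|f x - f z| < e.
  near (0:R)^'+ => d.
  exists d; split => // x z.
  by have : [set: {ptws K -> \bar R}] `<=` (fun x => forall z, box x d z -> `|f x - f z| < e);
    [near: d; exact: h | apply].
by exists d.
Unshelve. all: by end_near. Qed.

Lemma countable_fun_rat : countable [set: K -> rat].
Proof.
have [s hs] := finite_enum.
apply/countable_injP; exists (fun c : K -> rat => pickle [seq c k | k <- s]).
move=> c d _ _ /(pcan_inj pickleK) cd0; have cd := (@eq_in_map {classic K} rat c d s).2 cd0.
by apply/funext => k; exact: cd.
Qed.

Lemma measurable_box (c : K -> rat) (r : R) :
  measurable ([set x | forall k, `|contract (x k) - ratr (c k)| < r] : set (ebarP R K)).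
Proof.
rewrite (_ : [set x | _] = \bigcap_(k in [set: K])
   [set x : ebarP R K | `|contract (x k) - ratr (c k)| < r]).
  apply: fin_bigcap_measurable => // k _.
  rewrite (_ : [set x | _] = (fun x : ebarP R K => contract (proj k x)) @^-1` (ball (ratr (c k) : R) r)).
    rewrite -[X in measurable X]setTI.
    apply: (measurableT_comp measurable_contract (@proj_measurable R K k)) => //.
    exact: measurable_ball.
  by apply/seteqP; split => x /=; rewrite -ball_normE/= distrC.
by apply/seteqP; split => x /= h k => [_|]; exact: h.
Qed.

(** An open set is a union of boxes with rational centres and radii [1/(n+1)]. Finiteness of [K]
    makes this family countable and each box measurable for the product sigma-algebra. *)
Lemma open_measurable_cube (O : set {ptws K -> \bar R}) :
  open O -> measurable (O : set (ebarP R K)).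
Proof.
move=> oO.
pose B (p : (K -> rat) * nat) : set (ebarP R K) :=
  [set x | forall k, `|contract (x k) - ratr (p.1 k)| < p.2.+1%:R^-1].
pose D := [set p | B p `<=` O].
have -> : O = \bigcup_(p in D) B p.
  apply/seteqP; split => [x Ox|x [p Dp]]; last exact: Dp.
  have /nbhs_box[r r0 rO] : nbhs x O by exact: open_nbhs_nbhs.
  have r2 : 0 < r / 2 by rewrite divr_gt0.
  have [n _ /(_ n (leqnn n)) /= ne] := near_infty_natSinv_lt (PosNum r2).
  have dense (y e : R) : 0 < e -> exists q : rat, `|y - ratr q| < e.
    move=> e0; have lt_pm : y - e < y + e by lra.
    have [q] := rat_in_itvoo lt_pm.
    rewrite in_itv/= => /andP[q1 q2]; exists q; rewrite ltr_norml; apply/andP; split; lra.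
  have /choice[c hc] : forall k, exists q : rat, `|contract (x k) - ratr q| < n.+1%:R^-1.
    by move=> k; apply: dense; rewrite invr_gt0.
  exists (c, n) => // z zb; apply: rO => k.
  apply: le_lt_trans (ler_distD (ratr (c k)) _ _) _.
  move: (hc k) (zb k) ne; rewrite /= (distrC (ratr _)).
  by move: (n.+1%:R^-1) => e; lra.
have cU : countable [set: (K -> rat) * nat].
  by rewrite -setXTT; apply: countableX; [exact: countable_fun_rat|exact: countableP].
rewrite bigcup_mkcond; apply: countable_bigcupT_measurable => // p.
by case: ifP => // _; exact: measurable_box.
Qed.

Lemma continuous_measurable_cube (f : {ptws K -> \bar R} -> R) :
  continuous f -> measurable_fun [set: ebarP R K] f.
Proof.
move=> /continuousP cf.
apply: (measurability _ (RGenOpens.measurableE R)) => _ [_ [a [b ->]] <-].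
rewrite setTI; apply: open_measurable_cube; apply: cf.
exact: interval_open.
Qed.

End CompactCube.

(** * Integrals of bounded functions against a probability *)

Section BoundedIntegral.
Context d (T : measurableType d) (R : realType) (P : probability T R).

Lemma bounded_integrable (f : T -> R) (M : R) : measurable_fun setT f ->
  (forall x, `|f x| <= M) -> P.-integrable setT (EFin \o f).
Proof.
move=> mf fM; apply: measurable_bounded_integrable => //.
  by rewrite (le_lt_trans (probability_le1 _ _))// ltry.
exists M; split; first exact: num_real.
by move=> N MN x _ /=; rewrite (le_trans (fM x))// ltW.
Qed.

Lemma Rintegral_indic (A : set T) : measurable A ->
  \int[P]_x (\1_A x : R) = fine (P A).
Proof. by move=> mA; rewrite /Rintegral integral_indic// setIT. Qed.

(** The difference is dominated by [e + 2 * M * \1_B]: smallness off [B], boundedness on it. *)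
Lemma Rintegral_dist_le (phi psi : T -> R) (M e b : R) (B : set T) :
  measurable_fun setT phi -> measurable_fun setT psi ->
  (forall x, `|phi x| <= M) -> (forall x, `|psi x| <= M) ->
  measurable B -> (P B <= b%:E)%E -> 0 <= e -> 0 <= M ->
  (forall x, ~ B x -> `|phi x - psi x| <= e) ->
  `|\int[P]_x phi x - \int[P]_x psi x| <= e + 2 * M * b.
Proof.
move=> mphi mpsi phiM psiM mB PB e0 M0 h.
have iphi := bounded_integrable _ _ mphi phiM.
have ipsi := bounded_integrable _ _ mpsi psiM.
have mB1 : measurable_fun setT (\1_B : T -> R) by exact: measurable_indic.
have B1 x : `|\1_B x : R| <= 1 by rewrite ger0_norm// indicE; case: (_ \in _).
have iB := bounded_integrable _ _ mB1 B1.
have M2B x : `|2 * M * (\1_B x : R)| <= 2 * M.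
  by rewrite normrM ger0_norm ?mulr_ge0// ler_piMr ?mulr_ge0.
have imB : P.-integrable setT (EFin \o (fun x => 2 * M * (\1_B x : R))).
  by apply: (bounded_integrable _ (2 * M)) => //; exact: measurable_funM.
have ic : P.-integrable setT (EFin \o (fun _ : T => e)).
  by apply: (bounded_integrable _ `|e|).
rewrite -RintegralB//.
have mD : measurable_fun setT (fun x => phi x - psi x) by exact: measurable_funB.
have DM x : `|phi x - psi x| <= 2 * M.
  by rewrite (le_trans (ler_normB _ _))// mulrDl !mul1r lerD.
have iD : P.-integrable setT (EFin \o (fun x => phi x - psi x)).
  exact: bounded_integrable DM.
apply: (le_trans (le_normr_Rintegral _ iD)) => //.
have iB' : P.-integrable setT (EFin \o (fun x => e + 2 * M * (\1_B x : R))).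
  apply: (bounded_integrable (fun x => e + 2 * M * (\1_B x : R)) (e + 2 * M)).
    by apply: measurable_funD => //; exact: measurable_funM.
  by move=> x; rewrite (le_trans (ler_normD _ _))// lerD// ger0_norm.
apply: (@le_trans _ _ (\int[P]_x (e + 2 * M * (\1_B x : R)))).
  apply: le_Rintegral => //.
    apply: (bounded_integrable _ (2 * M)); first exact: measurableT_comp.
    by move=> x; rewrite normr_id.
  move=> x _; rewrite indicE; have [xB|xB] := boolP (x \in B).
    by rewrite mulr1 (le_trans (DM x))// lerDr.
  by rewrite mulr0 addr0 h// => Bx; move/negP: xB; apply; rewrite inE.
rewrite RintegralD// RintegralZl// Rintegral_indic//.
have -> : \int[P]__ e = e.
  have P1 : fine (P setT) = 1 by rewrite probability_setT.
  by rewrite Rintegral_cst// -[RHS]mulr1 -P1.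
rewrite lerD2l.
rewrite ler_wpM2l ?mulr_ge0//.
by rewrite -lee_fin fineK// fin_num_measure.
Qed.

End BoundedIntegral.

(** * Piecewise linear cut-offs *)

Section Ramp.
Context {R : realType}.
Implicit Types (t u : R).

(** The clamping of [t] to [0, 1], written with absolute values so that continuity is inherited from
    the norm. *)
Definition ramp t : R := (`|t| - `|t - 1| + 1) / 2.

Lemma continuous_ramp : continuous ramp.
Proof.
move=> t; rewrite /ramp; apply: cvgMl; apply: cvgD; last exact: cvg_cst.
apply: cvgB; first by apply: cvg_norm; exact: cvg_id.
by apply: cvg_norm; apply: cvgB; [exact: cvg_id|exact: cvg_cst].
Qed.

Lemma ramp_le0 t : t <= 0 -> ramp t = 0.
Proof.
move=> t0; rewrite /ramp !ler0_norm//; last by lra.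
by lra.
Qed.

Lemma ramp_ge1 t : 1 <= t -> ramp t = 1.
Proof. by move=> t1; rewrite /ramp !ger0_norm//; lra. Qed.

Lemma ramp_mid t : 0 <= t <= 1 -> ramp t = t.
Proof.
by move=> /andP[t0 t1]; rewrite /ramp ger0_norm// ler0_norm; lra.
Qed.

Lemma ramp_bounds t : 0 <= ramp t <= 1.
Proof.
have [t0|t0] := leP t 0; first by rewrite ramp_le0// lexx ler01.
have [t1|t1] := leP 1 t; first by rewrite ramp_ge1// lexx ler01.
by rewrite ramp_mid ?ltW// t0 t1.
Qed.

Lemma ramp_norm t : `|ramp t| <= 1.
Proof. by have /andP[? ?] := ramp_bounds t; rewrite ger0_norm. Qed.

(* Since [contract t = t / (1 + t)] for [0 <= t], this is the identity on [0, 1]. *)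
Definition unit_coord (u : \bar R) : R :=
  ramp (2 * contract u) / 2 / (1 - ramp (2 * contract u) / 2).

Lemma continuous_unit_coord : continuous unit_coord.
Proof.
have cw : continuous (fun u : \bar R => ramp (2 * contract u) / 2).
  move=> u; apply: cvgMl.
  apply: (@continuous_comp _ _ _ (fun u : \bar R => 2 * contract u) ramp).
    by apply: cvgMr; exact: continuous_contract.
  exact: continuous_ramp.
move=> u; rewrite /unit_coord; apply: cvgM; first exact: cw.
apply: cvgV; last by apply: cvgB; [exact: cvg_cst|exact: cw].
(* [ramp] is at most 1, so the denominator is at least 1/2. *)
by have := ramp_bounds (2 * contract u) => /andP[? ?]; rewrite subr_eq0; apply/eqP; lra.
Qed.

Lemma unit_coordE t : 0 <= t <= 1 -> unit_coord t%:E = t.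
Proof.
move=> /andP[t0 t1]; rewrite /unit_coord /= ger0_norm//.
have t10 : 0 < 1 + t by lra.
have tn0 : 1 + t != 0 by rewrite gt_eqF.
(* For [t] in [0, 1] the number [2 t / (1 + t)] is in [0, 1], so nothing is clamped, and
   [w / (1 - w)] inverts [t / (1 + t)]. *)
rewrite ramp_mid.
  by field; rewrite tn0/=; apply/eqP; lra.
apply/andP; split; first by rewrite mulr_ge0// divr_ge0// ltW.
by rewrite mulrA ler_pdivrMr//; lra.
Qed.

End Ramp.

(** * Continuity *)

Section QuantileApprox.
Context {R : realType}.
Implicit Types (m : probability (\bar R) R).

(* The distribution function of [contract + 1], which takes values in [0, 2]. *)
Definition lev m (y : R) : R := fine (m [set z | contract z + 1 <= y]).

Lemma measurable_lev (y : R) : measurable [set z : \bar R | contract z + 1 <= y].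
Proof.
rewrite (_ : [set _ | _] = @contract R @^-1` `]-oo, y - 1]%classic).
  by rewrite -[X in measurable X]setTI; apply: measurable_contract.
by apply/seteqP; split => z /=; rewrite in_itv/= lerBrDr.
Qed.

Lemma lev_le_indic m (y : R) : lev m y = \int[m]_z (\1_[set z | contract z + 1 <= y] z : R).
Proof. by rewrite Rintegral_indic//; exact: measurable_lev. Qed.

(** The Galois connection in the coordinate [contract + 1]. For [y > 2] both sides hold; for [y < 0]
    the left side is false while the right one holds at levels [u <= 0]. *)
Lemma quantile_lev m (u y : R) : u <= 1 -> 0 <= y ->
  (contract (quantile m u%:E) + 1 <= y) = (u <= lev m y).
Proof.
move=> u1 y0; have [y2|y2] := leP y 2; last first.
  rewrite /lev (_ : [set _ | _] = setT) ?probability_setT ?u1.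
    have := contract_le1 (quantile m u%:E); rewrite ler_norml => /andP[_ h].
    by apply/idP; lra.
  apply/seteqP; split => // z _ /=.
  by have := contract_le1 z; rewrite ler_norml => /andP[_ h]; lra.
have y1 : `|y - 1| <= 1 by rewrite ler_norml; apply/andP; split; lra.
rewrite -lerBrDr -le_expandRL ?inE// quantile_le1 ?lee_fin//.
rewrite /lev /cdf1 -[RHS]lee_fin fineK; last first.
  by rewrite fin_num_measure//; exact: measurable_lev.
congr (_ <= m _)%E; apply/seteqP; split => z /=.
  by rewrite le_expandRL ?inE// lerBrDr.
by rewrite le_expandRL ?inE// lerBrDr.
Qed.

(** Equal to 1 where [contract z + 1 <= k d] and to 0 beyond [(k + 1) d]. Its integral is weakly
    continuous in the measure, which [lev] is not, and lies between two consecutive grid values of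
    [lev]. *)
Definition hat (d : R) (k : nat) (z : \bar R) : R :=
  ramp (k.+1%:R - (contract z + 1) / d).

Lemma continuous_hat d k : continuous (hat d k).
Proof.
move=> z; apply: (@continuous_comp _ _ _ (fun z => k.+1%:R - (contract z + 1) / d) ramp).
  apply: cvgB; first exact: cvg_cst.
  by apply: cvgMl; apply: cvgD; [exact: continuous_contract|exact: cvg_cst].
exact: continuous_ramp.
Qed.

(** The extended line is treated as the cube indexed by [unit]. *)
Lemma continuous_measurable_ereal (f : \bar R -> R) : continuous f ->
  measurable_fun [set: \bar R] f.
Proof.
move=> cf; pose inj (x : \bar R) : ebarP R unit := fun=> x.
have minj : measurable_fun setT inj.
  apply: (@measurability _ _ (\bar R) (ebarP R unit) setT inj (@cyl R unit)) => //.
  by move=> _ [_ [k _ [A mA <-]] <-]; rewrite !setTI.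
have cf' : continuous (fun x : {ptws unit -> \bar R} => f (x tt)).
  move=> x; apply: (@continuous_comp _ _ _ (fun x : {ptws unit -> \bar R} => x tt) f).
    exact: continuous_eval.
  exact: cf.
have fin1 : finite_set [set: unit] by exact: finite_finset.
exact: (measurableT_comp (continuous_measurable_cube fin1 _ cf') minj).
Qed.

Lemma hat_bounds m (d : R) (k : nat) : 0 < d ->
  lev m (k%:R * d) <= \int[m]_z hat d k z <= lev m (k.+1%:R * d).
Proof.
move=> d0; have ih : m.-integrable setT (EFin \o hat d k).
  apply: (bounded_integrable _ _ _ _ _ 1); last by move=> x; exact: ramp_norm.
  exact/continuous_measurable_ereal/continuous_hat.
have ii (y : R) : m.-integrable setT
    (EFin \o (fun z => \1_[set z : \bar R | contract z + 1 <= y] z : R)).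
  apply: (bounded_integrable _ _ _ _ _ 1).
    by apply: measurable_indic; exact: measurable_lev.
  by move=> x; rewrite ger0_norm// indicE; case: (_ \in _).
rewrite !lev_le_indic; apply/andP; split; apply: le_Rintegral => // z _.
  have /andP[r0 _] := ramp_bounds (k.+1%:R - (contract z + 1) / d).
  rewrite indicE; have [|_] := boolP (z \in _); last exact: r0.
  rewrite inE /= => zk; rewrite /hat ramp_ge1//.
  have : (contract z + 1) / d <= k%:R by rewrite ler_pdivrMr.
  by rewrite -natr1; lra.
have /andP[_ r1] := ramp_bounds (k.+1%:R - (contract z + 1) / d).
rewrite indicE; have [_|] := boolP (z \in _); first exact: r1.
rewrite notin_setE/= => /negP; rewrite -ltNge => zk; rewrite /hat ramp_le0//.
by rewrite subr_le0 ler_pdivlMr// ltW.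
Qed.

(* Away from the levels [a k] every ramp is 0 or 1, and the maximum is the largest
   grid point [k * d] with [a k < t]: a continuous substitute for the quantile. *)
Definition stair (d eta : R) (n : nat) (a : nat -> R) (t : R) : R :=
  \big[Num.max/0]_(k < n.+1) (k%:R * d * ramp ((t - a k) / eta)).

Lemma continuous_stair d eta n a : continuous (stair d eta n a).
Proof.
rewrite /stair; elim: (index_enum _) => [|k r IH].
  rewrite (_ : (fun _ => _) = cst 0); first exact: cst_continuous.
  by apply/funext => t; rewrite big_nil.
rewrite (_ : (fun _ => _) = (fun t => k%:R * d * ramp ((t - a k) / eta))
   \max (fun t => \big[Num.max/0]_(k <- r) (k%:R * d * ramp ((t - a k) / eta)))); last first.
  by apply/funext => t; rewrite big_cons.
move=> t; apply: continuous_max; last exact: IH.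
apply: cvgMr; apply: (@continuous_comp _ _ _ (fun t => (t - a k) / eta) ramp).
  by apply: cvgMl; apply: cvgB; [exact: cvg_id|exact: cvg_cst].
exact: continuous_ramp.
Qed.

(** If [t > a k + eta], then [t > lev m (k d)] and the quantile exceeds [k d]; if [t < a k - eta],
    then [t < lev m ((k + 1) d)] and the quantile is at most [(k + 1) d]. Of the two steps in the
    error, one is the mesh of the grid and one the width of a hat. *)
Lemma stair_approx m (d eta : R) (n : nat) (a : nat -> R) :
  0 < d -> 0 < eta -> 2 <= n%:R * d ->
  (forall k, (k <= n)%N ->
     lev m (k%:R * d) - eta < a k /\ a k < lev m (k.+1%:R * d) + eta) ->
  forall t, t <= 1 -> (forall k, (k <= n)%N -> eta < `|t - a k|) ->
  `|contract (quantile m t%:E) + 1 - stair d eta n a t| <= 2 * d.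
Proof.
move=> d0 eta0 nd ha t t1 ht.
have := contract_le1 (quantile m t%:E); rewrite ler_norml => /andP[q1 q2].
have q_le k : (contract (quantile m t%:E) + 1 <= k%:R * d) = (t <= lev m (k%:R * d)).
  by rewrite quantile_lev// mulr_ge0// ltW.
set q := contract _ + 1 in q_le *.
have s0 : 0 <= stair d eta n a t by exact: bigmax_ge_id.
have le_q : stair d eta n a t <= q.
  apply: bigmax_le; first by rewrite /q; lra.
  move=> k _; have kn : (k <= n)%N by rewrite -ltnS.
  have [ha1 ha2] := ha k kn.
  have := ht k kn; rewrite lter_normr => /orP[tk|tk].
    rewrite ramp_ge1 ?mulr1; last by rewrite ler_pdivlMr// mul1r ltW.
    by rewrite ltW// ltNge q_le -ltNge; lra.
  rewrite ramp_le0 ?mulr0; first by rewrite /q; lra.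
  by rewrite pmulr_lle0 ?invr_gt0//; lra.
suff : q <= stair d eta n a t + 2 * d by rewrite ler_norml => ?; apply/andP; split; lra.
rewrite leNgt; apply/negP => qs.
(* At the least grid point above the staircase the ramp cannot be 1, so the level lies below [a k];
   the preceding grid point is still at most the staircase. *)
have ex : exists k, stair d eta n a t < k%:R * d.
  by exists n; apply: lt_le_trans nd; rewrite /q in qs; lra.
have [k sk kmin] := ex_minnP ex.
have kn : (k <= n)%N by apply: kmin; apply: lt_le_trans nd; rewrite /q in qs; lra.
case: k => [|k] in sk kmin kn *; first by rewrite mul0r ltNge s0 in sk.
have ks : k%:R * d <= stair d eta n a t.
  by rewrite leNgt; apply/negP => /kmin; rewrite ltnn.
have [ha1 ha2] := ha k.+1 kn.
have := ht k.+1 kn; rewrite lter_normr => /orP[tk|tk].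
  have kn' : (k.+1 < n.+1)%N by rewrite ltnS.
  have := @le_bigmax _ _ _ 0 (fun k : 'I_n.+1 => k%:R * d * ramp ((t - a k) / eta)) (Ordinal kn').
  rewrite /= ramp_ge1 ?mulr1; last by rewrite ler_pdivlMr// mul1r ltW.
  by rewrite leNgt sk.
have : q <= k.+2%:R * d by rewrite q_le; lra.
by rewrite -addn2 natrD mulrDl; lra.
Qed.

(* [g] and [B] depend on [m0] only: the same continuous function approximates the
   quantile functions of all [m] close to [m0], off a set that is small for the
   uniform law, hence for every copula measure. *)
Lemma near_quantile (m0 : probability (\bar R) R) (d e : R) : 0 < d -> 0 < e ->
  exists (g : \bar R -> \bar R) (B : set R),
  [/\ continuous g, measurable B, (lebesgue_measure B <= e%:E)%E &
   \forall m \near (m0 : WP1 R), forall t, 0 <= t <= 1 -> ~ B t ->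
     `|contract (quantile (m : probability (\bar R) R) t%:E) - contract (g t%:E)| <= 2 * d].
Proof.
move=> d0 e0.
have [n nd] : exists n : nat, 2 <= n%:R * d.
  exists (Num.trunc (2 / d)).+1.
  by rewrite -ler_pdivrMr// ltW// Num.Theory.truncnS_gt.
(* The [n + 1] closed balls of radius [eta] around the [a k] have total length at most [e]. *)
pose eta := e / (2 * n.+1%:R).
have eta0 : 0 < eta by rewrite divr_gt0// mulr_gt0.
pose a k := \int[m0]_z hat d k z.
pose cb (k : nat) : set R := closed_ball (a k) eta.
pose B := \big[setU/set0]_(k < n.+1) cb k.
exists (fun u => expand (stair d eta n a (unit_coord u) - 1)), B; split.
- move=> u; apply: (@continuous_comp _ _ _
    (fun u => stair d eta n a (unit_coord u) - 1) (@expand R)); last exact: continuous_expand.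
  apply: cvgB; last exact: cvg_cst.
  apply: (@continuous_comp _ _ _ unit_coord (stair d eta n a)).
    exact: continuous_unit_coord.
  exact: continuous_stair.
- by apply: bigsetU_measurable => k _; exact: measurable_closed_ball.
- have ub p : (lebesgue_measure (\big[setU/set0]_(k < p) cb k)
      <= (p%:R * (eta *+ 2))%:E)%E.
    elim: p => [|p IH]; first by rewrite big_ord0 measure0 mul0r.
    rewrite big_ord_recr/= (le_trans (measureU2 _ _ _))//.
    - by apply: bigsetU_measurable => k _; exact: measurable_closed_ball.
    - exact: measurable_closed_ball.
    apply: (@le_trans _ _ ((p%:R * (eta *+ 2))%:E + (eta *+ 2)%:E)%E).
      apply: leeD; first exact: IH.
      rewrite le_eqVlt; apply/orP; left; apply/eqP.
      exact: (lebesgue_measure_closed_ball (a p) (ltW eta0)).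
    by rewrite -EFinD -natr1 mulrDl mul1r.
  apply: (le_trans (ub n.+1)); rewrite lee_fin /eta.
  have : (n.+1%:R : R) != 0 by rewrite pnatr_eq0.
  move: (n.+1%:R : R) => N N0.
  by suff -> : N * (e / (2 * N) *+ 2) = e by []; field.
(* Weak closeness to [m0] is needed for these finitely many hats only. *)
- have near_a : \forall m \near (m0 : WP1 R), forall k, (k < n.+1)%N ->
      `|a k - \int[(m : probability (\bar R) R)]_z hat d k z| < eta.
    elim: n.+1 => [|p IH]; first by near=> m.
    have bh : continuous (hat d p) /\ exists M : R, forall x, `|hat d p x| <= M.
      by split; [exact: continuous_hat|exists 1 => x; exact: ramp_norm].
    pose h : CB R (\bar R) := exist _ (hat d p) bh.
    have : (fun m : WP1 R => wmap1 m h) @ (m0 : WP1 R) --> wmap1 m0 h.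
      apply: (@continuous_comp _ _ _ (@wmap1 R : WP1 R -> _)
         (fun F : {ptws CB R (\bar R) -> R} => F h)).
        exact: initial_continuous.
      exact: continuous_eval.
    move=> /cvgrPdist_lt/(_ _ eta0) nh.
    near=> m => k; rewrite ltnS leq_eqVlt => /predU1P[->|].
      by near: m; exact: nh.
    by move: k; near: m; exact: IH.
  apply: filterS near_a => m hm t /andP[t0 t1] tB.
  rewrite unit_coordE ?t0 ?t1//.
  rewrite -[X in X - _]/(contract _).
  (* Clamping does not increase distances, and the coordinate of the quantile is already in
     [-1, 1]. *)
  have := contract_expand_dist (contract (quantile m t%:E)) (stair d eta n a t - 1).
  rewrite contractK => /le_trans; apply.
  rewrite opprB addrA.
  apply: stair_approx => // k kn.
    have := hm k kn; rewrite ltr_distl => /andP[h1 h2].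
    have /andP[h3 h4] := hat_bounds m d k d0.
    by split; lra.
  rewrite ltNge; apply/negP => tk; apply: tB; rewrite /B.
  rewrite -bigcup_mkord; exists k => //=.
  by rewrite /cb closed_ballE//= /closed_ball_ /= distrC.
Unshelve. all: by end_near. Qed.

End QuantileApprox.

(** * Measurable maps into powers of the extended line *)

Section CubeMaps.
Context {R : realType}.

Lemma measurable_into_cube {d} {T : measurableType d} {K : Type}
    (f : T -> ebarP R K) :
  (forall k, measurable_fun setT (fun x => f x k)) -> measurable_fun setT f.
Proof.
move=> mf; apply: (@measurability _ _ T (ebarP R K) setT f (@cyl R K)) => //.
move=> _ [_ [k _ [A mA <-]] <-]; rewrite setTI.
by have := mf k measurableT _ mA; rewrite !setTI.
Qed.

Lemma measurable_qmap {K : Type} (m : K -> probability (\bar R) R) :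
  measurable_fun setT (qmap m : ebarP R K -> ebarP R K).
Proof.
apply: measurable_into_cube => k.
exact: (measurableT_comp (measurable_quantile (m k)) (@proj_measurable R K k)).
Qed.

(** A copy of [qmap] typed between product sigma-algebras, to carry the structure of a measurable
    function. *)
Definition qcube {K : Type} (m : K -> probability (\bar R) R) :
  ebarP R K -> ebarP R K := qmap m.

HB.instance Definition _ (K : Type) (m : K -> probability (\bar R) R) :=
  isMeasurableFun.Build _ _ (ebarP R K) (ebarP R K) (qcube m) (measurable_qmap m).

Lemma measurable_cube_comp {d} {T : measurableType d} {K : Type}
    (f : {ptws K -> \bar R} -> R) (G : T -> ebarP R K) :
  finite_set [set: K] -> continuous f -> measurable_fun setT G ->
  measurable_fun setT (fun x => f (G x)).
Proof.
by move=> finK cf mG; exact: (measurableT_comp (continuous_measurable_cube finK f cf) mG).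
Qed.

End CubeMaps.

(* Measures are total functions on sets, so equality of measures also concerns
   non-measurable sets: [mpatch P Q] is [P] with the junk values of [Q]. *)
Section Patch.
Local Open Scope ereal_scope.
Context {d} {T : measurableType d} {R : realType} (P Q : probability T R).

Definition mpatch (A : set T) : \bar R := if `[< measurable A >] then P A else Q A.

Lemma mpatchE (A : set T) : measurable A -> mpatch A = P A.
Proof. by move=> mA; rewrite /mpatch; case: asboolP. Qed.

Lemma mpatchNE (A : set T) : ~ measurable A -> mpatch A = Q A.
Proof. by move=> mA; rewrite /mpatch; case: asboolP. Qed.

Let mpatch0 : mpatch set0 = 0.
Proof. by rewrite mpatchE// measure0. Qed.

Let mpatch_ge0 A : 0 <= mpatch A.
Proof. by rewrite /mpatch; case: asboolP => _; exact: measure_ge0. Qed.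

Let mpatch_sigma_additive : semi_sigma_additive mpatch.
Proof.
move=> F mF tF mUF; rewrite mpatchE//.
rewrite (_ : (fun _ => _) = (fun n => \sum_(0 <= i < n) P (F i))).
  exact: measure_semi_sigma_additive.
by apply/funext => n; apply: eq_bigr => i _; rewrite mpatchE.
Qed.

HB.instance Definition _ := isMeasure.Build _ _ _ mpatch
  mpatch0 mpatch_ge0 mpatch_sigma_additive.

Let mpatch_setT : mpatch setT = 1.
Proof. by rewrite mpatchE// probability_setT. Qed.

HB.instance Definition _ := Measure_isProbability.Build _ _ _ mpatch mpatch_setT.

Lemma Rintegral_patch (f : T -> R) : Rintegral mpatch setT f = Rintegral P setT f.
Proof.
rewrite /Rintegral; congr fine; apply: eq_measure_integral => A mA _.
exact: mpatchE.
Qed.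

End Patch.

(** * Change of variables and union bounds *)

Section Transfer.
Context d d' (T : measurableType d) (T' : measurableType d') (R : realType).
Context (P : probability T R).

Lemma Rintegral_distribution (X : {mfun T >-> T'}) (f : T' -> R) (M : R) :
  measurable_fun setT f -> (forall x, `|f x| <= M) ->
  Rintegral (distribution P X) setT f = Rintegral P setT (f \o X).
Proof.
move=> mf fM; rewrite /Rintegral.
rewrite (@integral_distribution _ _ _ _ _ P X (EFin \o f))//.
  exact/measurable_EFinP.
apply: (@bounded_integrable _ _ _ P (f \o X) M).
  exact: measurableT_comp.
by move=> x /=; exact: fM.
Qed.

Lemma probability_bigsetU_le {K : Type} (s : seq K) (N : K -> set T) (b : R) :
  (forall k, measurable (N k)) -> (forall k, (P (N k) <= b%:E)%E) ->
  (P (\big[setU/set0]_(k <- s) N k) <= ((size s)%:R * b)%:E)%E.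
Proof.
move=> mN Nb; elim: s => [|k s IH]; first by rewrite big_nil measure0 mul0r.
rewrite big_cons (le_trans (measureU2 _ _ _))//.
  exact: bigsetU_measurable.
by rewrite /= -natr1 addrC mulrDl mul1r EFinD leeD.
Qed.

End Transfer.

(** The added units keep the denominator positive when [M] or [S] vanishes. *)
Lemma mul_bound_le {R : realFieldType} (M S c : R) : 0 <= M -> 0 <= S -> 0 <= c ->
  M * (S * (c / ((M + 1) * (S + 1)))) <= c.
Proof.
move=> M0 S0 c0; have X0 : 0 < (M + 1) * (S + 1) by rewrite mulr_gt0// ltr_wpDl.
move: X0; set X := (M + 1) * _ => X0.
rewrite (_ : M * _ = M * S / X * c); last by field; rewrite gt_eqF.
by rewrite ler_piMl// ler_pdivrMr// mul1r ler_pM// lerDl.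
Qed.

(** * The map and its continuity *)

Section Continuity.
Context {R : realType} {I : Type}.
Implicit Types (C : probability (ebarP R I) R) (m : I -> probability (\bar R) R).

(** Off the measurable sets the values of [p.1] are kept. As [sklar_copula] keeps those of [mu]
    there, surjectivity becomes an equality of total set functions. *)
Definition Phi (p : probability (ebarP R I) R * (I -> probability (\bar R) R)) :
  probability (ebarP R I) R := mpatch (distribution p.1 (qcube p.2)) p.1.

Lemma finite_Jt (J : FinSub I) : finite_set [set: Jt J].
Proof.
have -> : [set: Jt J] = (@proj1_sig I _) @^-1` (proj1_sig J).
  by apply/seteqP; split => // j _; exact: (proj2_sig j).
apply: finite_preimage; last exact: (proj2_sig J).
by move=> [i hi] [j hj] _ _ /= ij; subst j; rewrite (Prop_irrelevance hi hj).
Qed.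

Lemma Rintegral_margJ C (J : FinSub I) (f : {ptws Jt J -> \bar R} -> R) (M : R) :
  continuous f -> (forall x, `|f x| <= M) ->
  Rintegral (margJ C J) setT f = \int[C]_x f (fun j => x (proj1_sig j)).
Proof.
move=> cf fM; rewrite /margJ (Rintegral_distribution _ _ _ _ _ _ _ _ M)//.
by apply: continuous_measurable_cube => //; exact: finite_Jt.
Qed.

Lemma Rintegral_Phi C m (J : FinSub I) (f : {ptws Jt J -> \bar R} -> R) (M : R) :
  continuous f -> (forall x, `|f x| <= M) ->
  Rintegral (margJ (Phi (C, m)) J) setT f =
  \int[C]_x f (fun j => quantile (m (proj1_sig j)) (x (proj1_sig j))).
Proof.
move=> cf fM; rewrite (Rintegral_margJ _ _ _ M)// /Phi Rintegral_patch.
rewrite (Rintegral_distribution _ _ _ _ _ _ _ _ M)//.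
apply: (measurable_cube_comp f (@restr R I J)) => //; exact: finite_Jt.
Qed.

(** [N] also collects infinite coordinates and levels outside [0, 1]; these have mass zero since the
    marginal is uniform, so only [B] contributes. *)
Lemma copula_coord_le C (i : I) (B : set R) (b : R) :
  is_copula C -> measurable B -> (lebesgue_measure B <= b%:E)%E ->
  let N : set (ebarP R I) := @Defs.proj R I i @^-1` (~` (@EFin R @` (`[0, 1]%classic `\` B))) in
  measurable N /\ (C N <= b%:E)%E.
Proof.
move=> copC mB Bb N.
have mD : measurable (~` (@EFin R @` (`[0, 1]%classic `\` B))).
  apply: measurableC; apply: measurable_image_EFin; exact: measurableD.
split.
  by rewrite -[N]setTI; apply: (@proj_measurable R I i).
have -> : C N = marg1 C i (~` (@EFin R @` (`[0, 1]%classic `\` B))) by [].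
rewrite copC//; apply: le_trans Bb; apply: le_measure; rewrite ?inE//.
  apply: measurableI.
    by rewrite -[X in measurable X]setTI; apply: EFin_measurable.
  by rewrite -set_itvcc; exact: measurable_itv.
move=> t /= [tN t01]; apply: contrapT => tB; apply: tN; exists t => //.
Qed.

(** Off the union of the exceptional events the two arguments of [f] share a box of radius [d]. The
    bound involves [C] only through its being a copula measure, and [m] only through the last
    hypothesis. *)
Lemma copula_approx C m (J : FinSub I) (s : seq {classic Jt J})
    (f : {ptws Jt J -> \bar R} -> R) (M d e b : R)
    (g : Jt J -> \bar R -> \bar R) (B : Jt J -> set R) :
  is_copula C -> (forall k, k \in s) ->
  continuous f -> (forall x, `|f x| <= M) -> 0 <= M -> 0 <= e ->
  (forall j, continuous (g j)) ->
  (forall j, measurable (B j)) -> (forall j, (lebesgue_measure (B j) <= b%:E)%E) ->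
  (forall x z, box x d z -> `|f x - f z| < e) ->
  (forall j t, 0 <= t <= 1 -> ~ B j t ->
     `|contract (quantile (m (proj1_sig j)) t%:E) - contract (g j t%:E)| < d) ->
  `|\int[C]_x f (fun j => quantile (m (proj1_sig j)) (x (proj1_sig j))) -
    \int[C]_x f (fun j => g j (x (proj1_sig j)))| <= e + 2 * M * ((size s)%:R * b).
Proof.
move=> copC hs cf fM M0 e0 cg mB Bb fe hg.
pose N (j : Jt J) : set (ebarP R I) := @Defs.proj R I (proj1_sig j) @^-1` (~` (@EFin R @` (`[0, 1]%classic `\` B j))).
have NP j : measurable (N j) /\ (C (N j) <= b%:E)%E by exact: copula_coord_le.
have mf : measurable_fun [set: ebarP R (Jt J)] f.
  by apply: continuous_measurable_cube => //; exact: finite_Jt.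
apply: (@Rintegral_dist_le _ _ _ C _ _ M e _ (\big[setU/set0]_(j <- s) N j)) => //.
- apply: (measurable_cube_comp f (fun x : ebarP R I =>
    (fun j => quantile (m (proj1_sig j)) (x (proj1_sig j))) : ebarP R (Jt J))) => //.
    exact: finite_Jt.
  apply: measurable_into_cube => j.
  exact: (measurableT_comp (measurable_quantile _) (@proj_measurable R I (proj1_sig j))).
- apply: (measurable_cube_comp (fun x : {ptws Jt J -> \bar R} => f (fun j => g j (x j)))
    (@restr R I J)); [exact: finite_Jt| |exact: restr_measurable].
  move=> x; apply: (@continuous_comp _ _ _ (fun x : {ptws Jt J -> \bar R} =>
     (fun j => g j (x j)) : {ptws Jt J -> \bar R}) f); last exact: cf.
  move: x; apply: (@continuous_into_prod {ptws Jt J -> \bar R} (Jt J) (fun=> \bar R)) => j x.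
  apply: (@continuous_comp _ _ _ (fun x : {ptws Jt J -> \bar R} => x j) (g j)).
    exact: continuous_eval.
  exact: cg.
- by apply: bigsetU_measurable => j _; exact: (NP j).1.
- by apply: probability_bigsetU_le => j; [exact: (NP j).1|exact: (NP j).2].
- move=> x xN; apply: ltW; apply: fe => j.
  have /contrapT[t [t01 tB] tx] : ~ N j x.
    move=> Nj; apply: xN; have js := hs j; elim: s js {hs} => //= k s IH.
    rewrite inE big_cons => /predU1P[<-|js]; first by left.
    by right; exact: IH.
  have xt : x (proj1_sig j) = t%:E by rewrite tx.
  by rewrite xt; apply: hg => //; rewrite /= in_itv in t01.
Qed.

Local Notation domPhi := (PIw R I * {ptws I -> WP1 R})%type.

Lemma continuous_marginal (i : I) : continuous (fun p : domPhi => p.2 i : WP1 R).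
Proof.
move=> p; apply: (@continuous_comp _ _ _ (fun p : domPhi => p.2)
  (fun m : {ptws I -> WP1 R} => m i)); first exact: cvg_snd.
exact: continuous_eval.
Qed.

Lemma continuous_test_integral (J : FinSub I) (f : CB R {ptws Jt J -> \bar R}) :
  continuous (fun p : domPhi => wmapK (margJ p.1 J) f).
Proof.
move=> p; apply: (@continuous_comp _ _ _ (fun p : domPhi => p.1)
  (fun C : PIw R I => wmapK (margJ C J) f)); first exact: cvg_fst.
apply: (@continuous_comp _ _ _ (fun C : PIw R I => margJ C J : WPK R (Jt J))
  (fun nu : WPK R (Jt J) => wmapK nu f)).
  apply: (@continuous_comp _ _ _ (@fdd R I : PIw R I -> _)
    (fun F : prod_topology (fun J : FinSub I => WPK R (Jt J)) => F J)).
    exact: initial_continuous.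
  exact: continuous_eval.
apply: (@continuous_comp _ _ _ (@wmapK R (Jt J) : WPK R (Jt J) -> _)
  (fun F : {ptws CB R {ptws Jt J -> \bar R} -> R} => F f)).
  exact: initial_continuous.
exact: continuous_eval.
Qed.

(** The integrals of [f o q] at [p0] and at [p] are both compared with those of the same [f o g],
    whose dependence on the copula measure is weakly continuous: three errors of at most [e / 4]. *)
Lemma Phi_cvg (p0 : domPhi) (J : FinSub I) (f : CB R {ptws Jt J -> \bar R}) : is_copula p0.1 ->
  wmapK (margJ (Phi p) J) f
    @[p --> within [set p : domPhi | is_copula p.1]
             (nbhs (p0 : domPhi))]
    --> wmapK (margJ (Phi p0) J) f.
Proof.
move=> cop0; case: f => f [cf [M' fM']].
pose M := `|M'|.
have M0 : 0 <= M by exact: normr_ge0.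
have fM x : `|f x| <= M by rewrite (le_trans (fM' x))// ler_norm.
apply/cvgrPdist_lt => e e0.
have e8 : 0 < e / 8 by rewrite divr_gt0.
have [d d0 fd] := uniform_continuity_cube (finite_Jt J) f _ cf e8.
have [s hs] := finite_enum (finite_Jt J).
(* Chosen so that [2 M (size s) b <= e / 8]. *)
pose b := e / 16 / ((M + 1) * ((size s)%:R + 1)).
have MM1 : 0 < M + 1 by lra.
have ss1 : 0 < (size s)%:R + 1 :> R by rewrite ltr_wpDl.
have b0 : 0 < b by rewrite divr_gt0 ?divr_gt0// mulr_gt0.
have bound : e / 8 + 2 * M * ((size s)%:R * b) <= e / 4.
  have -> : e / 4 = e / 8 + 2 * (e / 16) by field.
  rewrite lerD2l -mulrA ler_pM2l// /b.
  by apply: mul_bound_le => //; rewrite ltW// divr_gt0.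
(* The approximation error is twice the mesh, and [2 d / 3 < d]. *)
have d3 : 0 < d / 3 by rewrite divr_gt0.
have /choice[gB hgB] : forall j : Jt J, exists gB : (\bar R -> \bar R) * set R,
  [/\ continuous gB.1, measurable gB.2, (lebesgue_measure gB.2 <= b%:E)%E &
   \forall m \near (p0.2 (proj1_sig j) : WP1 R), forall t, 0 <= t <= 1 -> ~ gB.2 t ->
     `|contract (quantile (m : probability (\bar R) R) t%:E) - contract (gB.1 t%:E)| < d].
  move=> j; have [g [B [cg mB Bb gB]]] := near_quantile (p0.2 (proj1_sig j)) _ _ d3 b0.
  exists (g, B); split => //; apply: filterS gB => m hm t t01 tB.
  by apply: (le_lt_trans (hm t t01 tB)); lra.
have cfg : continuous (fun x : {ptws Jt J -> \bar R} => f (fun j => (gB j).1 (x j))).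
  move=> x; apply: (@continuous_comp _ _ _ (fun x : {ptws Jt J -> \bar R} =>
     (fun j => (gB j).1 (x j)) : {ptws Jt J -> \bar R}) f); last exact: cf.
  move: x; apply: (@continuous_into_prod {ptws Jt J -> \bar R} (Jt J) (fun=> \bar R)) => j x.
  apply: (@continuous_comp _ _ _ (fun x : {ptws Jt J -> \bar R} => x j) (gB j).1).
    exact: continuous_eval.
  by have [cg _ _ _] := hgB j; exact: cg.
have bfg : exists N : R, forall x : {ptws Jt J -> \bar R}, `|f (fun j => (gB j).1 (x j))| <= N.
  by exists M => x; exact: fM.
pose fg : CB R {ptws Jt J -> \bar R} := exist _ _ (conj cfg bfg).
have e4 : 0 < e / 4 by rewrite divr_gt0.
pose good (m : I -> probability (\bar R) R) (j : Jt J) := forall t, 0 <= t <= 1 ->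
  ~ (gB j).2 t -> `|contract (quantile (m (proj1_sig j)) t%:E) - contract ((gB j).1 t%:E)| < d.
have near_m : \forall p \near (p0 : domPhi), forall j, good p.2 j.
  apply: (finite_near_forall (finite_Jt J) _ (nbhs (p0 : domPhi))
    (fun j p => good p.2 j)) => j.
  by have [_ _ _ h] := hgB j; exact: (continuous_marginal (proj1_sig j) p0 _ h).
have near_C : \forall p \near (p0 : domPhi),
   `|wmapK (margJ p0.1 J) fg - wmapK (margJ p.1 J) fg| < e / 4.
  by have /cvgrPdist_lt/(_ _ e4) := continuous_test_integral J fg p0.
set F : CB R {ptws Jt J -> \bar R} := exist _ f _.
have approx C m : is_copula C -> (forall j, good m j) ->
    `|wmapK (margJ (Phi (C, m)) J) F - wmapK (margJ C J) fg| <= e / 4.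
  move=> copC hm; apply: le_trans bound.
  rewrite /wmapK /= (Rintegral_Phi _ _ _ _ M)// (Rintegral_margJ _ _ _ M)//.
  apply: (@copula_approx C m J s f M d (e / 8) b (fun j => (gB j).1) (fun j => (gB j).2)) => //.
  - exact: ltW.
  - by move=> j; have [] := hgB j.
  - by move=> j; have [] := hgB j.
  - by move=> j; have [] := hgB j.
have h0 : `|wmapK (margJ (Phi p0) J) F - wmapK (margJ p0.1 J) fg| <= e / 4.
  case: p0 cop0 near_m {hgB near_C} => C m copC near_m.
  by apply: approx => //; exact: (nbhs_singleton near_m).
rewrite near_withinE.
apply: filterS2 near_C near_m => -[C m] /= h1 h2 h3.
have h4 := approx C m h3 h2.
rewrite distrC in h4.
apply: (le_lt_trans (ler_distD (wmapK (margJ p0.1 J) fg) _ _)).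
apply: (le_lt_trans (lerD h0 (ler_distD (wmapK (margJ C J) fg) _ _))).
lra.
Qed.

Lemma Phi_continuous :
  {within [set p : domPhi | is_copula p.1],
     continuous (Phi : domPhi -> PIw R I)}.
Proof.
apply/subspace_continuousP => p0 /= cop0.
apply: cvg_initial_topology; apply: cvg_prod_topology => J.
apply: cvg_initial_topology; apply: cvg_prod_topology => f.
exact: Phi_cvg.
Qed.

End Continuity.

(** * Surjectivity *)

Section ProbabilityLemmas.
Local Open Scope ereal_scope.
Context {d} {T : measurableType d} {R : realType}.

Lemma probability_eq (P Q : probability T R) :
  (P : set T -> \bar R) = (Q : set T -> \bar R) -> P = Q.
Proof.
case: P => p cp; case: Q => q cq /= pq; subst q; congr Probability.Pack.
case: cp => -[a1 a2] [a3] [a4] [a5] [a6] [a7] [a8].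
case: cq => -[b1 b2] [b3] [b4] [b5] [b6] [b7] [b8].
by rewrite (Prop_irrelevance a1 b1) (Prop_irrelevance a2 b2) (Prop_irrelevance a3 b3)
  (Prop_irrelevance a4 b4) (Prop_irrelevance a5 b5) (Prop_irrelevance a6 b6)
  (Prop_irrelevance a7 b7) (Prop_irrelevance a8 b8).
Qed.

Lemma negligible_measure_eq (P : probability T R) (A B : set T) :
  measurable A -> measurable B -> P.-negligible [set w | ~ (A w <-> B w)] ->
  P A = P B.
Proof.
move=> mA mB [N [mN N0 sN]].
have le_AB (C D : set T) : measurable C -> measurable D ->
    (forall w, ~ N w -> C w -> D w) -> P C <= P D.
  move=> mC mD CD; apply: (@le_trans _ _ (P (D `|` N))).
    apply: le_measure; rewrite ?inE//; first exact: measurableU.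
    by move=> w Cw; have [Nw|Nw] := pselect (N w); [right|left; exact: CD].
  by rewrite (le_trans (measureU2 _ _ _))// [X in _ + X](_ : _ = 0) ?adde0//.
have AB w : ~ N w -> (A w <-> B w).
  by move=> Nw; apply: contrapT => nAB; apply: Nw; exact: sN.
by apply/eqP; rewrite eq_le !le_AB// => w /AB[].
Qed.

(* The sets on which [X] and [Y] agree up to a null event form a sigma-algebra,
   so uncountably many coordinates cause no difficulty. *)
Lemma negligible_coord_eq (P : probability T R) {K : Type} (X Y : T -> ebarP R K) :
  (forall k, P.-negligible [set w | X w k <> Y w k]) ->
  forall A : set (ebarP R K), measurable A ->
    P.-negligible [set w | ~ (A (X w) <-> A (Y w))].
Proof.
move=> XY; apply: smallest_sub.
  split.
  - by rewrite (_ : [set _ | _] = set0); [exact: negligible_set0|apply/seteqP; split => // w /=; case; split].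
  - move=> A; apply: negligibleS => w /= nA; apply: contra_not nA => AXY.
    by rewrite /setD/=; split => -[_ h]; split => //; rewrite ?AXY// -?AXY//; move=> /AXY.
  - move=> F hF; have := negligible_bigcup hF; apply: negligibleS => w /= nF.
    apply: contrapT => nb; apply: nF.
    have FXY n : F n (X w) <-> F n (Y w).
      by apply: contrapT => h; apply: nb; exists n.
    by split => -[n _ /FXY h]; exists n.
move=> _ [k _ [A mA <-]]; have := XY k; apply: negligibleS => w /=.
by apply: contra_not => XYk; rewrite /preimage/= XYk.
Qed.

End ProbabilityLemmas.

(** * Distribution functions, their left limits and atoms *)

Section Cdf.
Local Open Scope ereal_scope.
Context {R : realType}.
Implicit Types (m : probability (\bar R) R).

Lemma cdf1_inj m1 m2 : (forall x, cdf1 m1 x = cdf1 m2 x) ->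
  forall A, measurable A -> m1 A = m2 A.
Proof.
move=> m12; pose G : set (set (\bar R)) := [set A | exists x : \bar R, A = [set y | y <= x]].
apply: (@measure_unique _ _ _ G (fun=> setT)).
- apply/seteqP; split.
    have -> : @measurable _ (\bar R) = <<s (@ErealGenOInfty.G R) >> by exact: ErealGenOInfty.measurableE.
    apply: smallest_sub; first exact: smallest_sigma_algebra.
    move=> _ [r ->].
    rewrite (_ : [set` _] = setT `\` [set y | y <= r%:E]).
      have [_ h _] := @smallest_sigma_algebra _ (@setT (\bar R)) G.
      by apply: h; apply: sub_sigma_algebra; exists r%:E.
    apply/seteqP; split => y /=; rewrite in_itv/= andbT ltNge.
      by move=> /negP; split.
    by move=> [_ /negP].
  apply: smallest_sub; first exact: sigma_algebra_measurable.
  by move=> _ [x ->]; exact: measurable_ray_le.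
- move=> _ _ [x ->] [y ->]; exists (Order.min x y).
  by apply/seteqP; split => z /=; rewrite le_min; [move=> [-> ->]|move=> /andP].
- by move=> _; exists +oo; apply/seteqP; split => // y _ /=; rewrite leey.
- by apply/seteqP; split => // y _; exists 0%N.
- by move=> _ [x ->]; exact: m12.
- by move=> _; rewrite (le_lt_trans (probability_le1 _ _))// ltry.
Qed.

Lemma cdf1_unit_inj m1 m2 :
  (forall t : R, (0 <= t <= 1)%R -> cdf1 m1 t%:E = t%:E) ->
  (forall t : R, (0 <= t <= 1)%R -> cdf1 m2 t%:E = t%:E) ->
  forall A, measurable A -> m1 A = m2 A.
Proof.
move=> h1 h2; apply: cdf1_inj => x.
have lt0 m : (forall t : R, (0 <= t <= 1)%R -> cdf1 m t%:E = t%:E) -> x < 0 -> cdf1 m x = 0.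
  move=> h x0; have h0 : cdf1 m 0 = 0 by apply: (h 0%R); rewrite lexx ler01.
  apply/eqP; rewrite eq_le cdf1_ge0 andbT -[leRHS]h0.
  exact: cdf1_homo (ltW x0).
have gt1 m : (forall t : R, (0 <= t <= 1)%R -> cdf1 m t%:E = t%:E) -> 1 <= x -> cdf1 m x = 1.
  move=> h x0; have h0 : cdf1 m 1 = 1 by apply: (h 1%R); rewrite lexx ler01.
  apply/eqP; rewrite eq_le cdf1_le1/= -[leLHS]h0.
  exact: cdf1_homo x0.
have [x0|x0] := ltP x 0; first by rewrite !lt0.
have [x1|x1] := leP 1 x; first by rewrite !gt1.
case: x {lt0 gt1} x0 x1 => [t t0 t1|//|//].
by rewrite h1 ?h2//; rewrite !lee_fin !lte_fin in t0 t1; rewrite t0 ltW.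
Qed.

Lemma measurable_cdf1 m : measurable_fun setT (cdf1 m).
Proof.
pose A : set (\bar R * \bar R) := [set p | p.2 <= p.1].
have mA : measurable A.
  rewrite -[A]setTI; apply: measurable_lee => //.
rewrite (_ : cdf1 m = m \o xsection A); first exact: measurable_fun_xsection.
apply/funext => x /=; rewrite /cdf1; congr (m _); apply/seteqP.
by split => y /=; rewrite /xsection/= inE.
Qed.

Lemma measurable_ray_lt_measure m : measurable_fun setT (fun x => m [set y | y < x]).
Proof.
pose A : set (\bar R * \bar R) := [set p | p.2 < p.1].
have mA : measurable A.
  rewrite -[A]setTI; apply: measurable_lte => //.
rewrite (_ : (fun _ => _) = m \o xsection A); first exact: measurable_fun_xsection.
apply/funext => x /=; congr (m _); apply/seteqP.
by split => y /=; rewrite /xsection/= inE.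
Qed.

Definition rcdf m (x : \bar R) : R := fine (cdf1 m x).
Definition lcdf m (x : \bar R) : R := fine (m [set y | y < x]).

Lemma rcdfE m x : (rcdf m x)%:E = cdf1 m x.
Proof.
by rewrite /rcdf fineK// fin_num_measure//; exact: measurable_ray_le.
Qed.

Lemma lcdfE m x : (lcdf m x)%:E = m [set y | y < x].
Proof.
by rewrite /lcdf fineK// fin_num_measure//; exact: measurable_ray_lt.
Qed.

Lemma lcdf_ge0 m x : (0 <= lcdf m x)%R.
Proof. by rewrite -lee_fin lcdfE. Qed.

Lemma rcdf_le1 m x : (rcdf m x <= 1)%R.
Proof. by rewrite -lee_fin rcdfE cdf1_le1. Qed.

Lemma atomE m x : m [set x] = (rcdf m x - lcdf m x)%:E.
Proof.
rewrite EFinB rcdfE lcdfE /cdf1 (_ : [set y | y <= x] = [set y | y < x] `|` [set x]).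
  rewrite measureU//; [|exact: measurable_ray_lt|].
    by rewrite addeAC subee ?add0e// fin_num_measure//; exact: measurable_ray_lt.
  by apply/seteqP; split => // y /= [+ yx]; rewrite yx ltxx.
apply/seteqP; split => y /=; rewrite le_eqVlt.
  by move=> /predU1P[->|yx]; [right|left].
by move=> [->|->]; rewrite ?eqxx ?orbT.
Qed.

Lemma lcdf_le_rcdf m x : (lcdf m x <= rcdf m x)%R.
Proof. by rewrite -subr_ge0 -lee_fin -atomE. Qed.

Lemma rcdf_le_lcdf m x y : x < y -> (rcdf m x <= lcdf m y)%R.
Proof.
move=> xy; rewrite -lee_fin rcdfE lcdfE; apply: le_measure; rewrite ?inE.
- exact: measurable_ray_le.
- exact: measurable_ray_lt.
- by move=> z /= /le_lt_trans; exact.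
Qed.

End Cdf.

(** * The distributional transform *)

Section DistributionalTransform.
Local Open Scope ereal_scope.
Context {R : realType}.

Definition lam01 (A : set R) : \bar R := lebesgue_measure (A `&` `[0%R, 1%R]%classic).

Let lam01_0 : lam01 set0 = 0.
Proof. by rewrite /lam01 set0I measure0. Qed.

Let lam01_ge0 A : 0 <= lam01 A.
Proof. exact: measure_ge0. Qed.

Let lam01_sigma_additive : semi_sigma_additive lam01.
Proof.
exact: (@measure_semi_sigma_additive _ _ _ (mrestr lebesgue_measure (measurable_itv `[0%R, 1%R]))).
Qed.

HB.instance Definition _ := isMeasure.Build _ _ _ lam01
  lam01_0 lam01_ge0 lam01_sigma_additive.

Let lam01_setT : lam01 setT = 1.
Proof.
by rewrite /lam01 setTI lebesgue_measure_itv/= lte_fin ltr01 -EFinB subr0.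
Qed.

HB.instance Definition _ := Measure_isProbability.Build _ _ _ lam01 lam01_setT.

Lemma lam01_ray_le (t : R) : (0 <= t <= 1)%R -> lam01 [set v | (v <= t)%R] = t%:E.
Proof.
move=> /andP[t0 t1]; rewrite /lam01.
rewrite (_ : _ `&` _ = `[0%R, t]%classic).
  rewrite lebesgue_measure_itv/= lte_fin; case: ltP => t0'; first by rewrite -EFinB subr0.
  by congr EFin; apply/eqP; rewrite eq_le t0 t0'.
apply/seteqP; split => v /=; rewrite !in_itv/=.
  by move=> [vt /andP[v0 v1]]; rewrite v0 vt.
by move=> /andP[v0 vt]; split => //; rewrite v0 (le_trans vt).
Qed.

Lemma lam01_ray_lt (t : R) : (0 <= t <= 1)%R -> lam01 [set v | (v < t)%R] = t%:E.
Proof.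
move=> /andP[t0 t1]; rewrite /lam01.
rewrite (_ : _ `&` _ = `[0%R, t[%classic).
  rewrite lebesgue_measure_itv/= lte_fin; case: ltP => t0'; first by rewrite -EFinB subr0.
  by congr EFin; apply/eqP; rewrite eq_le t0 t0'.
apply/seteqP; split => v /=; rewrite !in_itv/=.
  by move=> [vt /andP[v0 v1]]; rewrite v0 vt.
by move=> /andP[v0 vt]; split => //; rewrite v0 ltW// (lt_le_trans vt).
Qed.

(** Clamping [v] makes [F(x-) <= dtrans m x v <= F(x)] hold for every [v], not only almost
    surely. *)
Definition dtrans (m : probability (\bar R) R) (x : \bar R) (v : R) : R :=
  (lcdf m x + ramp v * (rcdf m x - lcdf m x))%R.

Lemma dtrans_bounds (m : probability (\bar R) R) x v : (lcdf m x <= dtrans m x v <= rcdf m x)%R.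
Proof.
have /andP[r0 r1] := ramp_bounds v; have lr := lcdf_le_rcdf m x.
rewrite /dtrans lerDl mulr_ge0 ?subr_ge0//= -lerBrDl ler_piMl// subr_ge0//.
Qed.

Lemma dtrans_le1 m x v : (dtrans m x v <= 1)%R.
Proof. by have /andP[_ h] := dtrans_bounds m x v; exact: le_trans h (rcdf_le1 m x). Qed.

Lemma quantile_dtrans_le (m : probability (\bar R) R) x v : quantile m (dtrans m x v)%:E <= x.
Proof.
rewrite quantile_le1 ?lee_fin ?dtrans_le1// -rcdfE lee_fin.
by have /andP[] := dtrans_bounds m x v.
Qed.

Context {d} {T : measurableType d} (mu : probability T R) (X : {mfun T >-> \bar R}).

Let m : probability (\bar R) R := distribution mu X.
Let P : probability (T * R)%type R := (mu \x lam01).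
Let U (w : T * R) : R := dtrans m (X w.1) w.2.

Lemma measurable_dtrans : measurable_fun setT (fun w : T * R => dtrans m (X w.1) w.2).
Proof.
have mX : measurable_fun setT (fun w : T * R => X w.1).
  exact: (measurableT_comp (measurable_funP X) measurable_fst).
have ml : measurable_fun setT (fun w : T * R => lcdf m (X w.1)).
  apply: (measurableT_comp (f := fine)) => //.
  exact: (measurableT_comp (measurable_ray_lt_measure m) mX).
have mr : measurable_fun setT (fun w : T * R => rcdf m (X w.1)).
  apply: (measurableT_comp (f := fine)) => //.
  exact: (measurableT_comp (measurable_cdf1 m) mX).
apply: measurable_funD => //; apply: measurable_funM; last exact: measurable_funB.
apply: (measurableT_comp (f := ramp)); last exact: measurable_snd.
by apply: continuous_measurable_fun; exact: continuous_ramp.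
Qed.

Let measurable_level (t : R) : measurable [set w | (U w <= t)%R].
Proof.
rewrite (_ : [set w | _] = setT `&` U @^-1` `]-oo, t]%classic).
  by apply: measurable_dtrans.
by rewrite setTI; apply/seteqP; split => w /=; rewrite in_itv.
Qed.

Let measurable_level_lt (t : R) : measurable [set w | (U w < t)%R].
Proof.
rewrite (_ : [set w | _] = setT `&` U @^-1` `]-oo, t[%classic).
  by apply: measurable_dtrans.
by rewrite setTI; apply/seteqP; split => w /=; rewrite in_itv.
Qed.

(** For [V] a lower ray, an initial segment of the lexicographic order on [(X, v)]. [dtrans] is
    monotone for this order, so such segments bracket the level sets of [U]. *)
Let below (q : \bar R) (V : set R) : set (T * R) :=
  ((X @^-1` [set y | y < q]) `*` setT) `|` ((X @^-1` [set q]) `*` V).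

Let measurable_preX (A : set (\bar R)) : measurable A -> measurable (X @^-1` A).
Proof. by move=> mA; rewrite -[X in measurable X]setTI; exact: measurable_funP. Qed.

Let measurable_below q V : measurable V -> measurable (below q V).
Proof.
move=> mV; apply: measurableU; apply: measurableX => //; apply: measurable_preX => //.
exact: measurable_ray_lt.
Qed.

Let P_prod (A : set T) (V : set R) : measurable A -> measurable V ->
  P (A `*` V) = mu A * lam01 V.
Proof. by move=> mA mV; exact: product_measure1E. Qed.

Let measure_below (q : \bar R) (V : set R) (p : R) : measurable V -> lam01 V = p%:E ->
  P (below q V) = (lcdf m q + p * (rcdf m q - lcdf m q))%:E.
Proof.
move=> mV Vp; rewrite /below measureU.
- rewrite [X in X + _](P_prod _ _ _ measurableT); last first.
    by apply: measurable_preX; exact: measurable_ray_lt.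
  rewrite [X in _ + X](P_prod _ _ _ mV); last exact: measurable_preX.
  rewrite [lam01 setT]lam01_setT mule1 Vp.
  rewrite -[mu (X @^-1` [set y | y < q])]/(m [set y | y < q]) -lcdfE.
  by rewrite -[mu (X @^-1` [set q])]/(m [set q]) atomE -EFinM -EFinD mulrC.
- by apply: measurableX => //; apply: measurable_preX; exact: measurable_ray_lt.
- by apply: measurableX => //; exact: measurable_preX.
- by apply/seteqP; split => // w /= [[+ _] [+ _]] => /[swap] ->; rewrite ltxx.
Qed.

(* At the quantile [q] of level [t], choose [p] with [t = F(q-) + p (F(q) - F(q-))]. *)
Let split_level (t : R) : (0 <= t <= 1)%R -> exists p : R, (0 <= p <= 1)%R /\
  let q := quantile m t%:E in t = (lcdf m q + p * (rcdf m q - lcdf m q))%R.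
Proof.
move=> /andP[t0 t1] /=; set q := quantile m t%:E.
have lt : (lcdf m q <= t)%R.
  by rewrite -lee_fin lcdfE; apply: measure_ray_lt_quantile; rewrite !lee_fin t0.
have tr : (t <= rcdf m q)%R by rewrite -lee_fin rcdfE -quantile_le1 ?lee_fin.
have [lr|lr] := eqVneq (rcdf m q) (lcdf m q).
  exists 0%R; rewrite lexx ler01 mul0r addr0; split => //.
  by apply/eqP; rewrite eq_le lt -lr tr.
have rl0 : (0 < rcdf m q - lcdf m q)%R.
  by rewrite subr_gt0 lt_neqAle eq_sym lr (le_trans lt).
exists ((t - lcdf m q) / (rcdf m q - lcdf m q))%R; split.
  by rewrite divr_ge0 ?subr_ge0 ?lcdf_le_rcdf//= ler_pdivrMr// mul1r lerD2r.
by rewrite divfK ?gt_eqF// addrC subrK.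
Qed.

Let dtrans_le_ge (t : R) : (0 <= t <= 1)%R -> t%:E <= P [set w | (U w <= t)%R].
Proof.
move=> t01; have [p [p01 /= tE]] := split_level _ t01.
move: (t01) => /andP[t0 t1].
set q := quantile m t%:E in tE.
rewrite [leLHS](_ : _ = P (below q [set v | (v <= p)%R])); last first.
  rewrite (measure_below _ _ _ _ (lam01_ray_le _ p01)) -?tE//.
  by rewrite -set_itvNyc; exact: measurable_itv.
apply: le_measure; rewrite ?inE//.
  by apply: measurable_below; rewrite -set_itvNyc; exact: measurable_itv.
move=> [x v] /= [[xq _]|[xq vp]]; rewrite /U /=.
  have /andP[_] := dtrans_bounds m (X x) v; move=> /le_trans; apply.
  rewrite -lee_fin rcdfE ltW// ltNge -quantile_le1 ?lee_fin// -ltNge//.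
rewrite xq /dtrans [leRHS]tE lerD2l ler_wpM2r ?subr_ge0 ?lcdf_le_rcdf//.
have [v0|v0] := leP v 0%R; first by rewrite ramp_le0//; case/andP: p01.
by rewrite ramp_mid// ltW//= (le_trans vp)//; case/andP: p01.
Qed.

(** Strictness matters: [U] may equal [t] at points beyond [q] when F is flat there. The gap to
    [U <= t] is closed by letting the level decrease to [t]. *)
Let dtrans_lt_le (t : R) : (0 <= t <= 1)%R -> P [set w | (U w < t)%R] <= t%:E.
Proof.
move=> t01; have [p [p01 /= tE]] := split_level _ t01.
move: (t01) => /andP[t0 t1].
set q := quantile m t%:E in tE.
rewrite [leRHS](_ : _ = P (below q [set v | (v < p)%R])); last first.
  rewrite (measure_below _ _ _ _ (lam01_ray_lt _ p01)) -?tE//.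
  by rewrite -set_itvNyo; exact: measurable_itv.
apply: le_measure; rewrite ?inE//.
  by apply: measurable_below; rewrite -set_itvNyo; exact: measurable_itv.
move=> [x v] /=; rewrite /U /= => Ut.
have tr : (t <= rcdf m q)%R by rewrite -lee_fin rcdfE -quantile_le1 ?lee_fin.
have [xq|xq|xq] := ltgtP (X x) q.
- by left.
- exfalso; have /andP[+ _] := dtrans_bounds m (X x) v.
  have := rcdf_le_lcdf m q (X x) xq.
  by move=> h1 /(le_trans (le_trans tr h1)); rewrite leNgt Ut.
- right; split => //=; rewrite ltNge; apply/negP => pv.
  move: Ut; apply/negP; rewrite -leNgt /dtrans xq [leLHS]tE lerD2l.
  rewrite ler_wpM2r ?subr_ge0 ?lcdf_le_rcdf//.
  have [v1|v1] := leP 1%R v; first by rewrite ramp_ge1//; case/andP: p01.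
  by rewrite ramp_mid// (ltW v1) andbT (le_trans _ pv)//; case/andP: p01.
Qed.

Lemma dtrans_uniform (t : R) : (0 <= t <= 1)%R ->
  (mu \x lam01) [set w | (dtrans m (X w.1) w.2 <= t)%R] = t%:E.
Proof.
move=> t01; rewrite -[LHS]/(P [set w | (U w <= t)%R]).
apply/eqP; rewrite eq_le dtrans_le_ge// andbT.
apply/lee_addgt0Pr => e e0; move: (t01) => /andP[t0 t1].
have [te|te] := leP (t + e)%R 1%R; last first.
  by rewrite (le_trans (probability_le1 _ _))// -EFinD lee_fin ltW.
apply: (@le_trans _ _ (P [set w | (U w < t + e)%R])).
  by apply: le_measure; rewrite ?inE// => w /= /le_lt_trans; apply; rewrite ltrDl.
by rewrite -EFinD; apply: dtrans_lt_le; rewrite te addr_ge0// ltW.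
Qed.

Lemma ereal_rat_between (x y : \bar R) : x < y -> exists r : rat, x <= (ratr r)%:E < y.
Proof.
have cut (a b : R) : (a < b)%R -> exists r : rat, (a <= ratr r < b)%R.
  move=> /rat_in_itvoo[r]; rewrite in_itv/= => /andP[ar rb]; exists r.
  by rewrite ltW.
case: x y => [a| |] [b| |] //=.
- by rewrite lte_fin => /cut[r h]; exists r; rewrite lee_fin lte_fin.
- move=> _; have [r /andP[h _]] : exists r : rat, (a <= ratr r < a + 1)%R.
    by apply: cut; rewrite ltrDl.
  by exists r; rewrite lee_fin h ltry.
- move=> _; have [r /andP[_ h]] : exists r : rat, (b - 1 <= ratr r < b)%R.
    by apply: cut; rewrite gtrBl.
  by exists r; rewrite leNye lte_fin.
- by move=> _; exists 0%R; rewrite leNye ltry.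
Qed.

(** If [q(U) < X], some rational [r] satisfies [q(U) <= r < X], that is [U <= F(r)] and not
    [X <= r]. The event [X <= r] lies inside [U <= F(r)] and both have mass [F(r)], so each of these
    countably many differences is null. *)
Lemma quantile_dtrans :
  (mu \x lam01).-negligible [set w | quantile m (dtrans m (X w.1) w.2)%:E <> X w.1].
Proof.
pose E (r : rat) := [set w : T * R | (U w <= rcdf m (ratr r)%:E)%R] `\`
   ((X @^-1` [set y | y <= (ratr r)%:E]) `*` setT).
have mB r : measurable ((X @^-1` [set y | y <= (ratr r : R)%:E]) `*` [set: R]).
  by apply: measurableX => //; apply: measurable_preX; exact: measurable_ray_le.
have r01 r : (0 <= rcdf m (ratr r)%:E <= 1)%R.
  by rewrite rcdf_le1 andbT (le_trans (lcdf_ge0 m (ratr r)%:E))// lcdf_le_rcdf.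
have E0 r : P.-negligible (E r).
  exists (E r); split => //; first exact: measurableD.
  rewrite measureD//; last by rewrite (le_lt_trans (probability_le1 _ _))// ltry.
  rewrite setIidr; last first.
    move=> [x v] /= [xr _]; have /andP[_ h] := dtrans_bounds m (X x) v.
    apply: (le_trans h); rewrite -lee_fin !rcdfE; exact: cdf1_homo.
  rewrite [X in X - _](_ : _ = (rcdf m (ratr r)%:E)%:E); last exact: dtrans_uniform.
  rewrite [X in _ - X](_ : _ = (rcdf m (ratr r)%:E)%:E) ?subee//.
  rewrite [LHS](P_prod _ _ _ measurableT); last first.
    by apply: measurable_preX; exact: measurable_ray_le.
  by rewrite [lam01 setT]lam01_setT mule1 -[mu _]/(cdf1 m (ratr r)%:E) -rcdfE.
pose F (n : nat) := if unpickle n is Some r then E r else set0.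
have : P.-negligible (\bigcup_n F n).
  apply: negligible_bigcup => n; rewrite /F; case: unpickle => [r|]; first exact: E0.
  exact: negligible_set0.
apply: negligibleS => -[x v] /= qx.
have qlt : quantile m (dtrans m (X x) v)%:E < X x.
  by rewrite lt_neqAle quantile_dtrans_le andbT; apply/eqP.
have [r /andP[qr rx]] := ereal_rat_between _ _ qlt.
exists (pickle r); first exact: Logic.I.
rewrite /F pickleK; split.
  rewrite /mkset /U /fst /snd.
  by rewrite -lee_fin rcdfE -quantile_le1// lee_fin dtrans_le1.
by move=> [xr _]; move: rx; rewrite ltNge xr.
Qed.

End DistributionalTransform.

(** * The copula measure of a given law *)

Section Sklar.
Context {R : realType} {I : Type} (mu : probability (ebarP R I) R).

(* A single uniform variable randomizes all coordinates at once. *)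
Definition sklar_map (w : ebarP R I * R) : ebarP R I :=
  fun i => (dtrans (marg1 mu i) (w.1 i) w.2)%:E.

Lemma measurable_sklar_map : measurable_fun setT sklar_map.
Proof.
apply: measurable_into_cube => i; apply/measurable_EFinP.
exact: (measurable_dtrans mu (@Defs.proj R I i)).
Qed.

HB.instance Definition _ :=
  isMeasurableFun.Build _ _ (ebarP R I * R)%type (ebarP R I) sklar_map measurable_sklar_map.

Definition sklar_copula : probability (ebarP R I) R :=
  mpatch (distribution (mu \x lam01)%E sklar_map) mu.

Lemma sklar_copulaE (A : set (ebarP R I)) : measurable A ->
  sklar_copula A = (mu \x lam01)%E (sklar_map @^-1` A).
Proof. by move=> mA; rewrite /sklar_copula/= mpatchE. Qed.

HB.instance Definition _ :=
  isMeasurableFun.Build _ _ R (\bar R) (@EFin R) (@EFin_measurable R setT).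

Lemma is_copula_sklar : is_copula sklar_copula.
Proof.
move=> i A mA.
(* The uniform law on the extended line is the image of [lam01] under [EFin]; the laws are compared
   through their distribution functions on [0, 1]. *)
rewrite (@cdf1_unit_inj R (marg1 sklar_copula i) (distribution lam01 (@EFin R)))//.
- move=> t t01; rewrite -[RHS](dtrans_uniform mu (@Defs.proj R I i) t t01).
  apply: sklar_copulaE; rewrite -[X in measurable X]setTI.
  by apply: (@proj_measurable R I i) => //; exact: measurable_ray_le.
- by move=> t t01; exact: lam01_ray_le.
Qed.

Lemma quantile_sklar_map (A : set (ebarP R I)) : measurable A ->
  (mu \x lam01)%E (sklar_map @^-1` (qcube (marg1 mu) @^-1` A)) = mu A.
Proof.
move=> mA.
have mq : measurable (qcube (marg1 mu) @^-1` A).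
  by rewrite -[X in measurable X]setTI; apply: measurable_qmap.
have mA1 : measurable (A `*` [set: R]) by exact: measurableX.
(* On the product space [q(U)] can be compared with the first projection, coordinate by coordinate
   and up to null sets. *)
transitivity ((mu \x lam01)%E (A `*` [set: R])); last first.
  by rewrite product_measure1E// [X in (_ * X)%E]probability_setT mule1.
apply: negligible_measure_eq => //.
  by rewrite -[X in measurable X]setTI; apply: measurable_sklar_map.
have := negligible_coord_eq (mu \x lam01)%E
  (fun w => qcube (marg1 mu) (sklar_map w)) (fun w => w.1)
  (fun i => quantile_dtrans mu (@Defs.proj R I i)) A mA.
apply: negligibleS => -[x v] /= h; apply: contra_not h => h.
by split => [/h|[/h]].
Qed.

Lemma Phi_sklar : Phi (sklar_copula, marg1 mu) = mu.
Proof.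
apply: probability_eq; apply/funext => A /=.
(* On a non-measurable set both patches fall through to the value of [mu]. *)
have [mA|nA] := pselect (measurable A); last by rewrite mpatchNE//= mpatchNE.
rewrite mpatchE// /distribution /pushforward -[RHS]quantile_sklar_map//.
apply: sklar_copulaE; rewrite -[X in measurable X]setTI.
exact: measurable_qmap.
Qed.

Lemma measurable_orthant (J : FinSub I) (v : Jt J -> \bar R) :
  measurable ([set x | forall j : Jt J, (x (proj1_sig j) <= v j)%E] : set (ebarP R I)).
Proof.
rewrite (_ : [set x | _] = \bigcap_(j in [set: Jt J])
    (@Defs.proj R I (proj1_sig j) @^-1` [set y | (y <= v j)%E])).
  apply: fin_bigcap_measurable; first exact: finite_Jt.
  move=> j _; rewrite -[X in measurable X]setTI.
  by apply: (@proj_measurable R I) => //; exact: measurable_ray_le.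
by apply/seteqP; split => x /= h j => [_|]; exact: h.
Qed.

Lemma sklar_cdf (J : FinSub I) (x : Jt J -> \bar R) :
  cdfJ (margJ sklar_copula J) (fun j => cdf1 (marg1 mu (proj1_sig j)) (x j))
  = cdfJ (margJ mu J) x.
Proof.
pose D (v : Jt J -> \bar R) : set (ebarP R I) :=
  [set y | forall j : Jt J, (y (proj1_sig j) <= v j)%E].
transitivity (sklar_copula (D (fun j => cdf1 (marg1 mu (proj1_sig j)) (x j)))); first by [].
transitivity (mu (D x)); last by [].
rewrite sklar_copulaE; last exact: measurable_orthant.
rewrite -quantile_sklar_map; last exact: measurable_orthant.
(* The two events coincide by the Galois connection, valid for infinite [x j] too because [U] is at
   most 1. *)
congr ((mu \x lam01)%E _); apply/seteqP; split => w /= h j; have := h j;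
  by rewrite /qcube /qmap quantile_le1// lee_fin dtrans_le1.
Qed.

End Sklar.

Theorem mainTheorem5 (R : realType) (I : Type) :
  exists Phi : probability (ebarP R I) R * (I -> probability (\bar R) R) ->
               probability (ebarP R I) R,
    (* Phi (C, (mu_i)_i) = ((F_{mu_i}^[-1])_{i in I})_* C  on copulas C *)
    (forall p : probability (ebarP R I) R * (I -> probability (\bar R) R),
       is_copula p.1 ->
       forall A : set (ebarP R I), measurable A ->
         Phi p A = p.1 (qmap p.2 @^-1` A)) /\
    (* continuity on C(\bar R^I) x prod_i P(\bar R) (subspace of the product) *)
    {within [set p : (PIw R I * {ptws I -> WP1 R})%type | is_copula p.1],
       continuous (Phi : (PIw R I * {ptws I -> WP1 R})%type -> PIw R I)} /\
    (* surjectivity *)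
    (forall mu : probability (ebarP R I) R,
       exists p, is_copula p.1 /\ Phi p = mu) /\
    (* in particular: Sklar-type representation *)
    (forall mu : probability (ebarP R I) R,
       exists C : probability (ebarP R I) R,
         [/\ is_copula C,
             Phi (C, marg1 mu) = mu &
             forall (J : FinSub I) (x : Jt J -> \bar R),
               cdfJ (margJ C J) (fun j => cdf1 (marg1 mu (proj1_sig j)) (x j))
               = cdfJ (margJ mu J) x]).
Proof.
exists Phi; split; [|split; [exact: Phi_continuous|split]].
- by move=> p _ A mA; rewrite /Phi/= mpatchE.
- move=> mu; exists (sklar_copula mu, marg1 mu).
  by split; [exact: is_copula_sklar|exact: Phi_sklar].
- move=> mu; exists (sklar_copula mu).
  by split; [exact: is_copula_sklar|exact: Phi_sklar|exact: sklar_cdf].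
Qed.
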